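(* Let $0<\alpha\le1$ and $0<\lambda\le1$. Then, as $T\to\infty$, \[ \int_1^T\left|\zeta_L\!\left(\tfrac12+it,\alpha,\lambda\right)\right|^2dt =T\log\frac{T}{2\pi}+\begin{cases}O\big(T(\log T)^{1/2}\big) & (0<\alpha<1),\\ O\big(T(\log T)^{3/4}\big) & (\alpha=1).\end{cases} \]
   Context: For $0<\alpha\le1$, $0<\lambda\le1$ and $s=\sigma+it$ with $\sigma>1$, the Lerch zeta-function is $\zeta_L(s,\alpha,\lambda)=\sum_{n=0}^\infty e^{2\pi i n\lambda}(n+\alpha)^{-s}$, extended to the complex plane by analytic continuation. In particular $\zeta_L(s,\alpha,1)$ is the Hurwitz zeta-function $\sum_{n=0}^\infty (n+\alpha)^{-s}$. *)

(* Defs.v *)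
From Stdlib Require Import Reals.
From Coquelicot Require Import Coquelicot.
Open Scope R_scope.

Definition cexp (z : C) : C :=
  (exp (Re z) * cos (Im z), exp (Re z) * sin (Im z)).

Definition cpow_pos (x : R) (s : C) : C := cexp (Cmult s (RtoC (ln x))).

Definition lerch_term (alpha lambda : R) (s : C) (n : nat) : C :=
  Cmult (cexp (0, 2 * PI * INR n * lambda))
        (cpow_pos (INR n + alpha) (Copp s)).

(* F is an analytic continuation of the Lerch zeta function to C \ {1}:
   F is complex-differentiable at every s <> 1 and coincides with the
   (convergent) Dirichlet series on the half-plane Re s > 1. By the identity
   theorem such an F is unique (and it exists), so it is zeta_L(.,alpha,lambda). *)
Definition is_lerch_zeta (alpha lambda : R) (F : C -> C) : Prop :=
  (forall s : C, s <> RtoC 1 -> @ex_derive C_AbsRing C_NormedModule F s) /\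
  (forall s : C, 1 < Re s ->
     @is_series C_AbsRing C_NormedModule (lerch_term alpha lambda s) (F s)).

Definition lerch_mean_square (F : C -> C) (T : R) : R :=
  RInt (fun t : R => (Cmod (F (1/2, t)))^2) 1 T.

(* Main.v *)
Require Import Defs.
From Stdlib Require Import Reals.
From Coquelicot Require Import Coquelicot.
From Stdlib Require Import ZArith Lra Lia Psatz ClassicalEpsilon.
Open Scope R_scope.

(** Uniformly in [t] with [Q t <= N], summation by parts gives
    [F (1/2 + i t) = S(t) + E(t)], where [S] is the partial sum of the series up to [N] and
    [E(t) = O(1 + sqrt N / t)]: the ratio of consecutive terms stays away from [1] when
    [lambda < 1], while for [lambda = 1] the sum minus the integral is [s] times an average
    of sums with exponent [s + 1], whose consecutive ratios are at distance of order [t / n]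
    from [1]. Since [F] is only known to be holomorphic and to agree with the series for
    [Re s > 1], the approximation is carried to the critical line by applying Goursat's
    theorem to [(F - S_M) exp (K (z - w)^2)] on a rectangle whose left side is centred at
    [w]: letting [M] and then [K] tend to infinity isolates the value at [w].

    With [N] of order [T], integrating [|S|^2] between end points averaged over a length
    [D = T / sqrt (log T)] makes the off-diagonal terms contribute [O(N^2 / D)], whence
    [int |S|^2 = T log T + O(T sqrt (log T))]. As [int |E|^2 = O(T)], the cross term is
    [O(T sqrt (log T))] too. This gives the exponent [1/2] for every [alpha]. *)

(** * Complex exponential and complex differentiability *)

(** The length [D] balances two costs: moving the end points by [D] changes the diagonal part by
    about [D log T], while the off-diagonal part costs [T^2 / D]; both are [T sqrt (log T)] at the
    chosen [D]. Without the averaging, a pair [m <> n] integrates to a term of size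
    [1 / (sqrt (m n) |log (n / m)|)], and these add up to order [N log N], as large as the main
    term. A second integration squares the logarithm in the denominator, and the square is summable
    near the diagonal.

    The error [sqrt N / t] is large for small [t], but only its mean square matters, and [N / t^2]
    integrates to [O(N)].

    The kernel [exp (K (z - w)^2)] is a Gaussian peak at [w] along the vertical line through [w]. It
    decays on the horizontal sides of a rectangle whose half-height exceeds its width, and grows
    only towards the right side, where the approximants converge to [F]. Taking [M] to infinity
    before [K] is what makes this growth harmless. *)

Lemma Cmod_pair (x y : R) : Cmod (x, y) = sqrt (x ^ 2 + y ^ 2).
Proof. reflexivity. Qed.

Lemma Cmod_sqr (z : C) : Cmod z ^ 2 = fst z ^ 2 + snd z ^ 2.
Proof. exact (Cmod2_alt z). Qed.

Lemma Cmod_le_abs (z : C) : Cmod z <= Rabs (fst z) + Rabs (snd z).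
Proof.
pose proof (Rabs_pos (fst z)); pose proof (Rabs_pos (snd z)).
apply Rsqr_incr_0_var; [|lra].
rewrite !Rsqr_pow2, Cmod_sqr, <- (pow2_abs (fst z)), <- (pow2_abs (snd z)).
nra.
Qed.

Lemma abs_fst_le_Cmod (z : C) : Rabs (fst z) <= Cmod z.
Proof. apply Rle_trans with (2 := Rmax_Cmod z), Rmax_l. Qed.

Lemma abs_snd_le_Cmod (z : C) : Rabs (snd z) <= Cmod z.
Proof. apply Rle_trans with (2 := Rmax_Cmod z), Rmax_r. Qed.

Lemma Cmod_minus_sym (a b : C) : Cmod (a - b) = Cmod (b - a).
Proof. rewrite <- (Cmod_opp (a - b)). f_equal. ring. Qed.

Lemma Cmod_triangle_minus (a b : C) : Cmod (a - b) <= Cmod a + Cmod b.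
Proof. rewrite <- (Cmod_opp b). apply Cmod_triangle. Qed.

Lemma Cmod_triangle_rev (a b : C) : Cmod a - Cmod b <= Cmod (a - b).
Proof.
pose proof (Cmod_triangle (a - b) b) as H.
replace (a - b + b)%C with a in H by ring. lra.
Qed.

(* Apply the real mean value theorem to the projection of [(u, v)] on its increment. *)
Lemma C_mean_value_ineq (u v du dv : R -> R) (p q B : R) : p <= q ->
  (forall x, p <= x <= q -> is_derive u x (du x)) ->
  (forall x, p <= x <= q -> is_derive v x (dv x)) ->
  (forall x, p <= x <= q -> Cmod (du x, dv x) <= B) ->
  Cmod (u q - u p, v q - v p) <= (q - p) * B.
Proof.
intros Hpq Hu Hv HB.
set (a := u q - u p). set (b := v q - v p).
destruct (MVT_gen (fun x => a * u x + b * v x) p q (fun x => a * du x + b * dv x))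
  as [c [Hc E]].
- intros x Hx. rewrite Rmin_left, Rmax_right in Hx by lra.
  apply (is_derive_plus (fun x => a * u x) (fun x => b * v x));
    apply is_derive_scal; [apply Hu|apply Hv]; lra.
- intros x Hx. rewrite Rmin_left, Rmax_right in Hx by lra.
  apply continuity_pt_filterlim.
  apply (continuous_plus (fun x => a * u x) (fun x => b * v x)).
  + apply (continuous_scal_r a u), (ex_derive_continuous u). eexists. apply Hu; lra.
  + apply (continuous_scal_r b v), (ex_derive_continuous v). eexists. apply Hv; lra.
- rewrite Rmin_left, Rmax_right in Hc by lra.
  specialize (HB c Hc).
  pose proof (Cmod_sqr (a, b)) as H1; pose proof (Cmod_sqr (du c, dv c)) as H2.
  pose proof (Cmod_ge_0 (a, b)); pose proof (Cmod_ge_0 (du c, dv c)).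
  simpl fst in *; simpl snd in *.
  assert (E' : a ^ 2 + b ^ 2 = (q - p) * (a * du c + b * dv c)) by (unfold a, b in *; nra).
  set (m := Cmod (a, b)) in *. set (k := Cmod (du c, dv c)) in *.
  assert (CS : a * du c + b * dv c <= m * k).
  { apply Rsqr_incr_0_var; [|nra].
    rewrite !Rsqr_pow2.
    replace ((m * k) ^ 2) with (m ^ 2 * k ^ 2) by ring. rewrite H1, H2.
    assert (0 <= (a * dv c - b * du c) ^ 2) by apply pow2_ge_0. nra. }
  assert (m ^ 2 <= m * ((q - p) * k)).
  { rewrite H1, E'. replace (m * ((q - p) * k)) with ((q - p) * (m * k)) by ring.
    apply Rmult_le_compat_l; lra. }
  assert ((q - p) * k <= (q - p) * B) by (apply Rmult_le_compat_l; lra).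
  destruct (Req_dec m 0) as [->|]; nra.
Qed.

Lemma cexp_plus (a b : C) : cexp (a + b) = (cexp a * cexp b)%C.
Proof.
destruct a as [a1 a2], b as [b1 b2]. unfold cexp, Re, Im, Cmult, Cplus; simpl.
rewrite exp_plus, cos_plus, sin_plus. f_equal; ring.
Qed.

Lemma cexp_0 : cexp 0 = 1.
Proof. unfold cexp; simpl. rewrite exp_0, cos_0, sin_0. unfold RtoC. f_equal; ring. Qed.

Lemma Cmod_cexp (z : C) : Cmod (cexp z) = exp (Re z).
Proof.
pose proof (exp_pos (Re z)).
rewrite <- (sqrt_pow2 (exp (Re z))) by lra.
unfold cexp. rewrite Cmod_pair. f_equal.
pose proof (sin2_cos2 (Im z)) as E. unfold Rsqr in E. nra.
Qed.

(** Along the segment from [b] to [a] the derivative is [a - b] times the exponential, and the real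
    part stays at most [M] on the whole segment by convexity. *)
Lemma cexp_lipschitz (a b : C) (M : R) :
  Re a <= M -> Re b <= M -> Cmod (cexp a - cexp b) <= exp M * Cmod (a - b).
Proof.
destruct a as [a1 a2], b as [b1 b2]; simpl; intros Ha Hb.
set (p := fun x => b1 + x * (a1 - b1)). set (q := fun x => b2 + x * (a2 - b2)).
set (h := ((a1, a2) - (b1, b2))%C).
replace (cexp (a1, a2) - cexp (b1, b2))%C with
  (exp (p 1) * cos (q 1) - exp (p 0) * cos (q 0),
   exp (p 1) * sin (q 1) - exp (p 0) * sin (q 0)).
2:{ unfold p, q, cexp, Cminus, Cplus, Copp; simpl.
    replace (b1 + 1 * (a1 - b1)) with a1 by ring.
    replace (b1 + 0 * (a1 - b1)) with b1 by ring.
    replace (b2 + 1 * (a2 - b2)) with a2 by ring.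
    replace (b2 + 0 * (a2 - b2)) with b2 by ring. reflexivity. }
replace (exp M * Cmod h) with ((1 - 0) * (exp M * Cmod h)) by ring.
apply (C_mean_value_ineq (fun x => exp (p x) * cos (q x)) (fun x => exp (p x) * sin (q x))
  (fun x => fst (h * cexp (p x, q x))%C) (fun x => snd (h * cexp (p x, q x))%C)); [lra|..].
- intros x _. unfold p, q, h, cexp, Cminus, Cplus, Copp; simpl. auto_derive; auto.
  unfold minus, plus, opp; simpl. ring.
- intros x _. unfold p, q, h, cexp, Cminus, Cplus, Copp; simpl. auto_derive; auto.
  unfold minus, plus, opp; simpl. ring.
- intros x Hx. rewrite <- surjective_pairing, Cmod_mult, Cmod_cexp, Rmult_comm.
  apply Rmult_le_compat_r; [apply Cmod_ge_0|].
  assert (p x <= M) as [H|H] by (unfold p; nra).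
  + left. apply exp_increasing, H.
  + simpl. rewrite H. lra.
Qed.

(** The function [cexp (x h) - x h] of real [x] has derivative [h (cexp (x h) - 1)], which the
    Lipschitz bound already makes quadratic in [h]. *)
Lemma cexp_quadratic (h : C) : Cmod h <= 1 -> Cmod (cexp h - 1 - h) <= exp 1 * Cmod h ^ 2.
Proof.
destruct h as [a b]; intros Hh.
pose proof (abs_fst_le_Cmod (a, b)) as Ha; simpl in Ha.
assert (Ha' : a <= 1) by (pose proof (Rle_abs a); lra).
replace (cexp (a, b) - 1 - (a, b))%C with
  ((exp (1 * a) * cos (1 * b) - 1 * a) - (exp (0 * a) * cos (0 * b) - 0 * a),
   (exp (1 * a) * sin (1 * b) - 1 * b) - (exp (0 * a) * sin (0 * b) - 0 * b)).
2:{ unfold cexp, Cminus, Cplus, Copp; simpl.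
    rewrite !Rmult_0_l, !Rmult_1_l, exp_0, cos_0, sin_0. f_equal; ring. }
replace (exp 1 * Cmod (a, b) ^ 2) with ((1 - 0) * (exp 1 * Cmod (a, b) ^ 2)) by ring.
apply (C_mean_value_ineq (fun x => exp (x * a) * cos (x * b) - x * a)
  (fun x => exp (x * a) * sin (x * b) - x * b)
  (fun x => fst ((a, b) * (cexp (x * (a, b)) - cexp 0))%C)
  (fun x => snd ((a, b) * (cexp (x * (a, b)) - cexp 0))%C)); [lra|..].
- intros x _. rewrite cexp_0. unfold cexp, Cminus, Cplus, Copp; simpl. auto_derive; auto.
  rewrite !Rmult_0_l, Rminus_0_r, Rplus_0_r. ring.
- intros x _. rewrite cexp_0. unfold cexp, Cminus, Cplus, Copp; simpl. auto_derive; auto.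
  rewrite !Rmult_0_l, Rminus_0_r, Rplus_0_r. ring.
- intros x Hx. rewrite <- surjective_pairing, Cmod_mult.
  pose proof (Cmod_ge_0 (a, b)). pose proof (exp_pos 1).
  apply Rle_trans with (Cmod (a, b) * (exp 1 * Cmod (x * (a, b) - 0))).
  + apply Rmult_le_compat_l; [lra|]. apply cexp_lipschitz; simpl; nra.
  + replace (x * (a, b) - 0)%C with (x * (a, b))%C by ring.
    rewrite Cmod_mult, Cmod_R, Rabs_pos_eq by lra.
    apply Rle_trans with (Cmod (a, b) * (exp 1 * (1 * Cmod (a, b)))); [|right; ring].
    apply Rmult_le_compat_l; [lra|]. apply Rmult_le_compat_l; [lra|].
    apply Rmult_le_compat_r; lra.
Qed.

(** The increment form avoids division and holds trivially at [w = z], so the rules of calculus need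
    no punctured neighbourhoods. *)
Definition cdiff (f : C -> C) (z l : C) : Prop :=
  forall eps, 0 < eps -> exists del, 0 < del /\
    forall w, Cmod (w - z) < del -> Cmod (f w - f z - l * (w - z)) <= eps * Cmod (w - z).

Definition holo (f : C -> C) (z : C) : Prop := exists l, cdiff f z l.

Lemma holo_of_ex_derive (f : C -> C) (z : C) :
  @ex_derive C_AbsRing C_NormedModule f z -> holo f z.
Proof.
intros [l [_ H]]. exists l. intros eps Heps.
destruct (H z (fun P HP => HP) (mkposreal eps Heps)) as [[d Hd] Hloc].
exists d. split; [exact Hd|]. intros w Hw.
assert (HB : @ball (AbsRing_UniformSpace C_AbsRing) z d w) by exact Hw.
specialize (Hloc w HB). simpl in Hloc.
change (Cmod ((f w - f z) - (w - z) * l)%C <= eps * Cmod (w - z)) in Hloc.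
rewrite Cmult_comm. exact Hloc.
Qed.

Lemma cdiff_local_lipschitz (f : C -> C) (z l : C) : cdiff f z l ->
  exists del, 0 < del /\ forall w, Cmod (w - z) < del ->
    Cmod (f w - f z) <= (Cmod l + 1) * Cmod (w - z).
Proof.
intros H. destruct (H 1 Rlt_0_1) as [d [Hd H1]]. exists d. split; [exact Hd|].
intros w Hw. specialize (H1 w Hw).
replace (f w - f z)%C with ((f w - f z - l * (w - z)) + l * (w - z))%C by ring.
eapply Rle_trans; [apply Cmod_triangle|]. rewrite Cmod_mult. lra.
Qed.

Lemma holo_const (c z : C) : holo (fun _ => c) z.
Proof.
exists 0. intros eps Heps. exists 1. split; [lra|]. intros w _.
replace (c - c - 0 * (w - z))%C with (RtoC 0) by ring.
rewrite Cmod_0. pose proof (Cmod_ge_0 (w - z)). nra.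
Qed.

Lemma holo_id (z : C) : holo (fun w => w) z.
Proof.
exists 1. intros eps Heps. exists 1. split; [lra|]. intros w _.
replace (w - z - 1 * (w - z))%C with (RtoC 0) by ring.
rewrite Cmod_0. pose proof (Cmod_ge_0 (w - z)). nra.
Qed.

Lemma holo_plus (f g : C -> C) (z : C) :
  holo f z -> holo g z -> holo (fun w => f w + g w)%C z.
Proof.
intros [l Hf] [m Hg]. exists (l + m)%C. intros eps Heps.
destruct (Hf (eps / 2)) as [d [Hd H1]]; [lra|].
destruct (Hg (eps / 2)) as [e [He H2]]; [lra|].
exists (Rmin d e). split; [apply Rmin_pos; assumption|]. intros w Hw.
specialize (H1 w (Rlt_le_trans _ _ _ Hw (Rmin_l _ _))).
specialize (H2 w (Rlt_le_trans _ _ _ Hw (Rmin_r _ _))).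
replace (f w + g w - (f z + g z) - (l + m) * (w - z))%C with
  ((f w - f z - l * (w - z)) + (g w - g z - m * (w - z)))%C by ring.
eapply Rle_trans; [apply Cmod_triangle|]. lra.
Qed.

Lemma holo_comp (f g : C -> C) (z : C) :
  holo g z -> holo f (g z) -> holo (fun w => f (g w)) z.
Proof.
intros [m Hg] [l Hf]. exists (l * m)%C. intros eps Heps.
destruct (cdiff_local_lipschitz _ _ _ Hg) as [d1 [Hd1 L]].
pose proof (Cmod_ge_0 l) as Hl; pose proof (Cmod_ge_0 m) as Hm.
destruct (Hf (eps / (2 * (Cmod m + 1)))) as [d2 [Hd2 H1]].
{ apply Rdiv_lt_0_compat; lra. }
destruct (Hg (eps / (2 * (Cmod l + 1)))) as [d3 [Hd3 H2]].
{ apply Rdiv_lt_0_compat; lra. }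
exists (Rmin (Rmin d1 d3) (d2 / (Cmod m + 1))). split.
{ repeat apply Rmin_pos; try assumption. apply Rdiv_lt_0_compat; lra. }
intros w Hw.
assert (W1 : Cmod (w - z) < d1).
{ apply Rlt_le_trans with (1 := Hw). eapply Rle_trans; [apply Rmin_l|apply Rmin_l]. }
assert (W3 : Cmod (w - z) < d3).
{ apply Rlt_le_trans with (1 := Hw). eapply Rle_trans; [apply Rmin_l|apply Rmin_r]. }
assert (W2 : Cmod (w - z) < d2 / (Cmod m + 1)).
{ apply Rlt_le_trans with (1 := Hw). apply Rmin_r. }
specialize (L w W1). specialize (H2 w W3).
assert (W : Cmod (g w - g z) < d2).
{ apply Rle_lt_trans with (1 := L).
  replace d2 with ((Cmod m + 1) * (d2 / (Cmod m + 1))) by (field; lra).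
  apply Rmult_lt_compat_l; lra. }
specialize (H1 _ W).
replace (f (g w) - f (g z) - l * m * (w - z))%C with
  ((f (g w) - f (g z) - l * (g w - g z)) + l * (g w - g z - m * (w - z)))%C by ring.
eapply Rle_trans; [apply Cmod_triangle|]. rewrite Cmod_mult.
set (k := Cmod (w - z)) in *. assert (0 <= k) by apply Cmod_ge_0.
apply Rle_trans with (eps / 2 * k + eps / 2 * k); [|lra].
apply Rplus_le_compat.
- apply Rle_trans with (1 := H1).
  apply Rle_trans with (eps / (2 * (Cmod m + 1)) * ((Cmod m + 1) * k)).
  + apply Rmult_le_compat_l; [|exact L]. left; apply Rdiv_lt_0_compat; lra.
  + right; field; lra.
- apply Rle_trans with ((Cmod l + 1) * (eps / (2 * (Cmod l + 1)) * k)).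
  + apply Rmult_le_compat; try lra. apply Cmod_ge_0.
  + right; field; lra.
Qed.

Lemma holo_sqr (z : C) : holo (fun w => w * w)%C z.
Proof.
exists (2 * z)%C. intros eps Heps. exists eps. split; [exact Heps|]. intros w Hw.
replace (w * w - z * z - 2 * z * (w - z))%C with ((w - z) * (w - z))%C by ring.
rewrite Cmod_mult. apply Rmult_le_compat_r; [apply Cmod_ge_0|lra].
Qed.

Lemma holo_scal (c : C) (f : C -> C) (z : C) : holo f z -> holo (fun w => c * f w)%C z.
Proof.
intros H. apply (holo_comp (fun u => c * u)%C f z H).
exists c. intros eps Heps. exists 1. split; [lra|]. intros w _.
replace (c * w - c * f z - c * (w - f z))%C with (RtoC 0) by ring.
rewrite Cmod_0. pose proof (Cmod_ge_0 (w - f z)). nra.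
Qed.

Lemma holo_ext (f g : C -> C) (z : C) : (forall w, f w = g w) -> holo f z -> holo g z.
Proof.
intros E [l H]. exists l. intros eps Heps. destruct (H eps Heps) as [d [Hd K]].
exists d. split; [exact Hd|]. intros w Hw. rewrite <- !E. apply K, Hw.
Qed.

(* Polarization reduces products to squares. *)
Lemma holo_mult (f g : C -> C) (z : C) :
  holo f z -> holo g z -> holo (fun w => f w * g w)%C z.
Proof.
intros Hf Hg.
apply holo_ext with (fun w => (1 / 4) * ((f w + g w) * (f w + g w))
   + (- (1 / 4)) * ((f w + (-(1)) * g w) * (f w + (-(1)) * g w)))%C.
{ intros w. field. }
assert (Hm : holo (fun w => f w + (-(1)) * g w)%C z).
{ apply holo_plus; [exact Hf|]. apply holo_scal, Hg. }
apply holo_plus; apply holo_scal.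
- apply (holo_comp (fun u => u * u)%C (fun w => f w + g w)%C); [apply holo_plus; assumption|].
  apply holo_sqr.
- apply (holo_comp (fun u => u * u)%C (fun w => f w + (-(1)) * g w)%C); [exact Hm|].
  apply holo_sqr.
Qed.

Lemma holo_cexp (z : C) : holo cexp z.
Proof.
exists (cexp z). intros eps Heps.
assert (Hc : 0 < Cmod (cexp z) * exp 1).
{ rewrite Cmod_cexp. apply Rmult_lt_0_compat; apply exp_pos. }
exists (Rmin 1 (eps / (Cmod (cexp z) * exp 1))). split.
{ apply Rmin_pos; [lra|]. apply Rdiv_lt_0_compat; assumption. }
intros w Hw.
assert (W1 : Cmod (w - z) <= 1) by (left; apply Rlt_le_trans with (1 := Hw), Rmin_l).
assert (W2 : Cmod (w - z) <= eps / (Cmod (cexp z) * exp 1))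
  by (left; apply Rlt_le_trans with (1 := Hw), Rmin_r).
replace w with (z + (w - z))%C at 1 by ring. rewrite cexp_plus.
replace (cexp z * cexp (w - z) - cexp z - cexp z * (w - z))%C with
  (cexp z * (cexp (w - z) - 1 - (w - z)))%C by ring.
rewrite Cmod_mult.
apply Rle_trans with (Cmod (cexp z) * (exp 1 * Cmod (w - z) ^ 2)).
{ apply Rmult_le_compat_l; [apply Cmod_ge_0|]. apply cexp_quadratic, W1. }
replace (Cmod (cexp z) * (exp 1 * Cmod (w - z) ^ 2)) with
  ((Cmod (cexp z) * exp 1) * Cmod (w - z) * Cmod (w - z)) by ring.
apply Rmult_le_compat_r; [apply Cmod_ge_0|].
replace eps with ((Cmod (cexp z) * exp 1) * (eps / (Cmod (cexp z) * exp 1)))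
  by (field; split; apply Rgt_not_eq; [apply exp_pos | rewrite Cmod_cexp; apply exp_pos]).
apply Rmult_le_compat_l; lra.
Qed.

(** The remainder of the linear approximation is exactly [(w - z)^2 / (w z^2)], and [|w| >= |z| / 2]
    near [z]. *)
Lemma holo_inv (z : C) : z <> 0 -> holo Cinv z.
Proof.
intros Hz. exists (- / (z * z))%C. intros eps Heps.
pose proof (proj1 (Cmod_gt_0 z) Hz) as Hp.
set (r := Cmod z) in *.
assert (Hr3 : 0 < r ^ 3) by (apply pow_lt, Hp).
exists (Rmin (r / 2) (eps * r ^ 3 / 2)). split.
{ apply Rmin_pos; [lra|]. nra. }
intros w Hw.
assert (W1 : Cmod (w - z) <= r / 2) by (left; apply Rlt_le_trans with (1 := Hw), Rmin_l).
assert (W2 : Cmod (w - z) <= eps * r ^ 3 / 2)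
  by (left; apply Rlt_le_trans with (1 := Hw), Rmin_r).
assert (Hwr : r / 2 <= Cmod w).
{ pose proof (Cmod_triangle_rev z (z - w)) as H.
  replace (z - (z - w))%C with w in H by ring.
  rewrite (Cmod_minus_sym z w) in H. fold r in H. lra. }
assert (Hw0 : w <> 0) by (apply Cmod_gt_0; lra).
replace (/ w - / z - - / (z * z) * (w - z))%C with ((w - z) * (w - z) / (w * (z * z)))%C
  by (field; split; assumption).
rewrite Cmod_div by (repeat apply Cmult_neq_0; assumption).
rewrite !Cmod_mult. fold r.
set (k := Cmod (w - z)) in *. assert (0 <= k) by apply Cmod_ge_0.
assert (H3 : r ^ 3 / 2 <= Cmod w * (r * r)) by (simpl; nra).
assert (H4 : 0 < Cmod w * (r * r)) by lra.
apply (Rmult_le_reg_r (Cmod w * (r * r))); [exact H4|].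
replace (k * k / (Cmod w * (r * r)) * (Cmod w * (r * r))) with (k * k)
  by (field; split; apply Rgt_not_eq; nra).
assert (k * k <= k * (eps * r ^ 3 / 2)) by (apply Rmult_le_compat_l; lra).
assert (eps * k * (r ^ 3 / 2) <= eps * k * (Cmod w * (r * r)))
  by (apply Rmult_le_compat_l; [nra|lra]).
lra.
Qed.

(** * Finite complex sums *)

Definition Csum (g : nat -> C) (n m : nat) : C := @sum_n_m C_AbelianMonoid g n m.

Lemma Csum_n_n (g : nat -> C) (n : nat) : Csum g n n = g n.
Proof. apply sum_n_n. Qed.

Lemma Csum_n_Sm (g : nat -> C) (n m : nat) : (n <= S m)%nat ->
  Csum g n (S m) = (Csum g n m + g (S m))%C.
Proof. exact (@sum_n_Sm C_AbelianMonoid g n m). Qed.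

Lemma Csum_Chasles (g : nat -> C) (n m k : nat) : (n <= S m)%nat -> (m <= k)%nat ->
  Csum g n k = (Csum g n m + Csum g (S m) k)%C.
Proof. exact (@sum_n_m_Chasles C_AbelianMonoid g n m k). Qed.

Lemma holo_Csum (f : nat -> C -> C) (n m : nat) (z : C) : (n <= m)%nat ->
  (forall k, holo (f k) z) -> holo (fun w => Csum (fun k => f k w) n m) z.
Proof.
intros Hnm H. induction Hnm as [|m Hnm IH].
- apply holo_ext with (f n); [intros w; rewrite Csum_n_n; reflexivity|apply H].
- apply holo_ext with (fun w => Csum (fun k => f k w) n m + f (S m) w)%C.
  + intros w. rewrite Csum_n_Sm by lia. reflexivity.
  + apply holo_plus; [exact IH|apply H].
Qed.

(** * Goursat's theorem on rectangles *)

Lemma RInt_Rmult (f : R -> R) (a b k : R) : ex_RInt f a b ->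
  RInt (fun x => k * f x) a b = k * RInt f a b.
Proof. exact (RInt_scal f a b k). Qed.

Lemma RInt_Rplus (f g : R -> R) (a b : R) : ex_RInt f a b -> ex_RInt g a b ->
  RInt (fun x => f x + g x) a b = RInt f a b + RInt g a b.
Proof. exact (RInt_plus f g a b). Qed.

Lemma RInt_Rminus (f g : R -> R) (a b : R) : ex_RInt f a b -> ex_RInt g a b ->
  RInt (fun x => f x - g x) a b = RInt f a b - RInt g a b.
Proof. exact (RInt_minus f g a b). Qed.

Lemma ex_RInt_Rmult (f : R -> R) (a b k : R) : ex_RInt f a b ->
  ex_RInt (fun x => k * f x) a b.
Proof. exact (ex_RInt_scal f a b k). Qed.

Lemma ex_RInt_Rplus (f g : R -> R) (a b : R) : ex_RInt f a b -> ex_RInt g a b ->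
  ex_RInt (fun x => f x + g x) a b.
Proof. exact (ex_RInt_plus f g a b). Qed.

Lemma ex_RInt_Rminus (f g : R -> R) (a b : R) : ex_RInt f a b -> ex_RInt g a b ->
  ex_RInt (fun x => f x - g x) a b.
Proof. exact (ex_RInt_minus f g a b). Qed.

(** * Integrals of complex-valued functions of a real variable *)

Definition CInt (f : R -> C) (a b : R) : C :=
  (RInt (fun x => fst (f x)) a b, RInt (fun x => snd (f x)) a b).

Definition ex_CInt (f : R -> C) (a b : R) : Prop :=
  ex_RInt (fun x => fst (f x)) a b /\ ex_RInt (fun x => snd (f x)) a b.

Lemma CInt_Chasles (f : R -> C) (a b c : R) : ex_CInt f a b -> ex_CInt f b c ->
  CInt f a c = (CInt f a b + CInt f b c)%C.
Proof.
intros [H1 H2] [H3 H4]. unfold CInt, Cplus; simpl. f_equal; symmetry.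
- exact (RInt_Chasles _ _ _ _ H1 H3).
- exact (RInt_Chasles _ _ _ _ H2 H4).
Qed.

Lemma ex_CInt_sub (f : R -> C) (a b c d : R) : a <= c -> c <= d -> d <= b ->
  ex_CInt f a b -> ex_CInt f c d.
Proof.
intros H1 H2 H3 [H4 H5].
split; apply (ex_RInt_Chasles_1 (V := R_CompleteNormedModule) _ c d b); try lra;
  apply (ex_RInt_Chasles_2 (V := R_CompleteNormedModule) _ a c b); auto; lra.
Qed.

Lemma ex_CInt_plus (f g : R -> C) (a b : R) : ex_CInt f a b -> ex_CInt g a b ->
  ex_CInt (fun x => f x + g x)%C a b.
Proof.
intros [H1 H2] [H3 H4]. split; simpl.
- exact (ex_RInt_plus _ _ _ _ H1 H3).
- exact (ex_RInt_plus _ _ _ _ H2 H4).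
Qed.

Lemma CInt_plus (f g : R -> C) (a b : R) : ex_CInt f a b -> ex_CInt g a b ->
  CInt (fun x => f x + g x)%C a b = (CInt f a b + CInt g a b)%C.
Proof.
intros [H1 H2] [H3 H4]. unfold CInt, Cplus; simpl. f_equal.
- exact (RInt_plus _ _ _ _ H1 H3).
- exact (RInt_plus _ _ _ _ H2 H4).
Qed.

Lemma ex_CInt_scal (c : C) (f : R -> C) (a b : R) : ex_CInt f a b ->
  ex_CInt (fun x => c * f x)%C a b.
Proof.
intros [H1 H2]. split; simpl.
- apply ex_RInt_Rminus; apply ex_RInt_Rmult; assumption.
- apply ex_RInt_Rplus; apply ex_RInt_Rmult; assumption.
Qed.

Lemma CInt_scal (c : C) (f : R -> C) (a b : R) : ex_CInt f a b ->
  CInt (fun x => c * f x)%C a b = (c * CInt f a b)%C.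
Proof.
intros [H1 H2]. unfold CInt, Cmult; simpl. f_equal.
- rewrite RInt_Rminus, !RInt_Rmult; auto using ex_RInt_Rmult.
- rewrite RInt_Rplus, !RInt_Rmult; auto using ex_RInt_Rmult.
Qed.

Lemma CInt_ext (f g : R -> C) (a b : R) : a <= b ->
  (forall x, a < x < b -> f x = g x) -> CInt f a b = CInt g a b.
Proof.
intros Hab H. unfold CInt. f_equal; apply RInt_ext; intros x;
rewrite Rmin_left, Rmax_right by lra; intros Hx; rewrite H; auto.
Qed.

(** The integral [z] is paired with itself: [|z|^2] is the integral of the real inner product of [z]
    with [f], hence at most [|z|] times the integral of [g]. *)
Lemma Cmod_CInt_le (f : R -> C) (g : R -> R) (a b : R) : a <= b ->
  ex_CInt f a b -> ex_RInt g a b -> (forall x, a < x < b -> Cmod (f x) <= g x) ->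
  Cmod (CInt f a b) <= RInt g a b.
Proof.
intros Hab [H1 H2] Hg H.
set (z := CInt f a b). destruct (Req_dec (Cmod z) 0) as [E|E].
{ rewrite E. apply RInt_ge_0; auto. intros x Hx.
  eapply Rle_trans; [apply Cmod_ge_0|apply H, Hx]. }
assert (Hz : 0 < Cmod z) by (pose proof (Cmod_ge_0 z); lra).
apply (Rmult_le_reg_l (Cmod z)); [exact Hz|].
replace (Cmod z * Cmod z) with (Cmod z ^ 2) by ring. rewrite Cmod_sqr.
pose proof (ex_RInt_Rmult _ a b (fst z) H1) as S1.
pose proof (ex_RInt_Rmult _ a b (snd z) H2) as S2.
pose proof (RInt_Rplus _ _ _ _ S1 S2) as P. rewrite !RInt_Rmult in P by assumption.
change (RInt (fun x => fst (f x)) a b) with (fst z) in P.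
change (RInt (fun x => snd (f x)) a b) with (snd z) in P.
replace (fst z ^ 2 + snd z ^ 2) with (fst z * fst z + snd z * snd z) by ring.
rewrite <- P, <- RInt_Rmult by exact Hg.
apply RInt_le; auto using ex_RInt_Rplus, ex_RInt_Rmult.
intros x Hx. apply Rle_trans with (Cmod z * Cmod (f x)).
- apply Rsqr_incr_0_var; [|apply Rmult_le_pos; apply Cmod_ge_0].
  rewrite !Rsqr_pow2.
  replace ((Cmod z * Cmod (f x)) ^ 2) with (Cmod z ^ 2 * Cmod (f x) ^ 2) by ring.
  rewrite !Cmod_sqr.
  assert (0 <= (fst z * snd (f x) - snd z * fst (f x)) ^ 2) by apply pow2_ge_0. nra.
- apply Rmult_le_compat_l; [lra|]. apply H, Hx.
Qed.

Lemma Cmod_CInt_le_const (f : R -> C) (M a b : R) : a <= b ->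
  ex_CInt f a b -> (forall x, a < x < b -> Cmod (f x) <= M) ->
  Cmod (CInt f a b) <= (b - a) * M.
Proof.
intros Hab Hf H.
rewrite <- (RInt_const a b M : _ = (b - a) * M).
apply Cmod_CInt_le; auto. apply ex_RInt_const.
Qed.

Lemma CInt_antiderivative (f F : R -> C) (a b : R) : a <= b ->
  (forall x, is_derive (fun x => fst (F x)) x (fst (f x))) ->
  (forall x, is_derive (fun x => snd (F x)) x (snd (f x))) ->
  (forall x, continuous (fun x => fst (f x)) x) ->
  (forall x, continuous (fun x => snd (f x)) x) ->
  ex_CInt f a b /\ CInt f a b = (F b - F a)%C.
Proof.
intros Hab H1 H2 C1 C2.
pose proof (is_RInt_derive (fun x => fst (F x)) (fun x => fst (f x)) a b
  (fun x _ => H1 x) (fun x _ => C1 x)) as I1.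
pose proof (is_RInt_derive (fun x => snd (F x)) (fun x => snd (f x)) a b
  (fun x _ => H2 x) (fun x _ => C2 x)) as I2.
split; [split; eexists; eassumption|].
unfold CInt. rewrite (is_RInt_unique _ _ _ _ I1), (is_RInt_unique _ _ _ _ I2).
reflexivity.
Qed.

Lemma holo_continuous_path (f : C -> C) (p : R -> C) (x : R) :
  holo f (p x) -> (forall y, Cmod (p y - p x) <= Rabs (y - x)) ->
  continuous (fun y => fst (f (p y))) x /\ continuous (fun y => snd (f (p y))) x.
Proof.
intros [l Hf] Hp.
destruct (cdiff_local_lipschitz _ _ _ Hf) as [d [Hd L]].
pose proof (Cmod_ge_0 l) as Hl.
assert (G : forall eps : posreal, exists e : posreal, forall y, Rabs (y - x) < e ->
    Cmod (f (p y) - f (p x)) < eps).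
{ intros eps.
  assert (He : 0 < Rmin d (eps / (Cmod l + 1))).
  { apply Rmin_pos; [exact Hd|]. apply Rdiv_lt_0_compat; [apply cond_pos|lra]. }
  exists (mkposreal _ He). simpl. intros y Hy.
  assert (Y1 : Rabs (y - x) < d) by (apply Rlt_le_trans with (1 := Hy), Rmin_l).
  assert (Y2 : Rabs (y - x) < eps / (Cmod l + 1))
    by (apply Rlt_le_trans with (1 := Hy), Rmin_r).
  specialize (Hp y).
  eapply Rle_lt_trans; [apply L; lra|].
  replace (pos eps) with ((Cmod l + 1) * (eps / (Cmod l + 1))) by (field; lra).
  apply Rmult_lt_compat_l; lra. }
split; apply filterlim_locally; intros eps; destruct (G eps) as [e He]; exists e;
  intros y Hy; specialize (He y Hy);
  (eapply Rle_lt_trans; [|exact He]).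
- apply (abs_fst_le_Cmod (f (p y) - f (p x))).
- apply (abs_snd_le_Cmod (f (p y) - f (p x))).
Qed.

Lemma Cmod_horizontal (x y c : R) : Cmod ((y, c) - (x, c)) <= Rabs (y - x).
Proof.
eapply Rle_trans; [apply Cmod_le_abs|]. simpl.
replace (c + - c) with 0 by ring. rewrite Rabs_R0. unfold Rminus. lra.
Qed.

Lemma Cmod_vertical (x y c : R) : Cmod ((c, y) - (c, x)) <= Rabs (y - x).
Proof.
eapply Rle_trans; [apply Cmod_le_abs|]. simpl.
replace (c + - c) with 0 by ring. rewrite Rabs_R0. unfold Rminus. lra.
Qed.

(** * Contour integrals over rectangles *)

Definition holo_rect (f : C -> C) (a b c d : R) : Prop :=
  forall x y, a <= x <= b -> c <= y <= d -> holo f (x, y).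

Lemma ex_CInt_horizontal (f : C -> C) (a b c d y : R) : a <= b ->
  holo_rect f a b c d -> c <= y <= d -> ex_CInt (fun x => f (x, y)) a b.
Proof.
intros Hab H Hy. split; apply (ex_RInt_continuous (V := R_CompleteNormedModule)); intros x;
rewrite Rmin_left, Rmax_right by lra; intros Hx;
apply (holo_continuous_path f (fun x => (x, y)));
try (apply H; lra); intros; apply Cmod_horizontal.
Qed.

Lemma ex_CInt_vertical (f : C -> C) (a b c d x : R) : c <= d ->
  holo_rect f a b c d -> a <= x <= b -> ex_CInt (fun y => f (x, y)) c d.
Proof.
intros Hab H Hy. split; apply (ex_RInt_continuous (V := R_CompleteNormedModule)); intros y;
rewrite Rmin_left, Rmax_right by lra; intros Hx;
apply (holo_continuous_path f (fun y => (x, y)));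
try (apply H; lra); intros; apply Cmod_vertical.
Qed.

(** The counterclockwise contour integral along the boundary; the factor [Ci] is there because
    [dz = i dy] on the vertical sides. *)
Definition rect_int (f : C -> C) (a b c d : R) : C :=
  (CInt (fun x => f (x, c)) a b - CInt (fun x => f (x, d)) a b
   + Ci * (CInt (fun y => f (b, y)) c d - CInt (fun y => f (a, y)) c d))%C.

Lemma holo_rect_sub (f : C -> C) (a b c d a' b' c' d' : R) :
  a <= a' -> b' <= b -> c <= c' -> d' <= d ->
  holo_rect f a b c d -> holo_rect f a' b' c' d'.
Proof. intros H1 H2 H3 H4 H x y Hx Hy. apply H; lra. Qed.

Lemma rect_int_split_x (f : C -> C) (a m b c d : R) : a <= m -> m <= b -> c <= d ->
  holo_rect f a b c d -> rect_int f a b c d = (rect_int f a m c d + rect_int f m b c d)%C.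
Proof.
intros H1 H2 H3 H. unfold rect_int.
assert (E : forall y, c <= y <= d -> CInt (fun x => f (x, y)) a b =
  (CInt (fun x => f (x, y)) a m + CInt (fun x => f (x, y)) m b)%C).
{ intros y Hy.
  pose proof (ex_CInt_horizontal f a b c d y (Rle_trans _ _ _ H1 H2) H Hy) as K.
  apply CInt_Chasles; apply (ex_CInt_sub _ a b); auto; lra. }
rewrite (E c), (E d) by lra. ring.
Qed.

Lemma rect_int_split_y (f : C -> C) (a b c m d : R) : a <= b -> c <= m -> m <= d ->
  holo_rect f a b c d -> rect_int f a b c d = (rect_int f a b c m + rect_int f a b m d)%C.
Proof.
intros H1 H2 H3 H. unfold rect_int.
assert (E : forall x, a <= x <= b -> CInt (fun y => f (x, y)) c d =
  (CInt (fun y => f (x, y)) c m + CInt (fun y => f (x, y)) m d)%C).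
{ intros x Hx.
  pose proof (ex_CInt_vertical f a b c d x (Rle_trans _ _ _ H2 H3) H Hx) as K.
  apply CInt_Chasles; apply (ex_CInt_sub _ c d); auto; lra. }
rewrite (E a), (E b) by lra. ring.
Qed.

Lemma Cmod_rect_int_le (f : C -> C) (a b c d M : R) : a <= b -> c <= d ->
  holo_rect f a b c d ->
  (forall x y, a <= x <= b -> c <= y <= d -> Cmod (f (x, y)) <= M) ->
  Cmod (rect_int f a b c d) <= 2 * ((b - a) + (d - c)) * M.
Proof.
intros H1 H2 H HM. unfold rect_int.
assert (E1 : forall y, c <= y <= d -> Cmod (CInt (fun x => f (x, y)) a b) <= (b - a) * M).
{ intros y Hy. apply Cmod_CInt_le_const; auto.
  - eapply ex_CInt_horizontal; eauto.
  - intros; apply HM; lra. }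
assert (E2 : forall x, a <= x <= b -> Cmod (CInt (fun y => f (x, y)) c d) <= (d - c) * M).
{ intros x Hx. apply Cmod_CInt_le_const; auto.
  - eapply ex_CInt_vertical; eauto.
  - intros; apply HM; lra. }
eapply Rle_trans; [apply Cmod_triangle|]. rewrite Cmod_mult, Cmod_Ci, Rmult_1_l.
pose proof (Cmod_triangle_minus (CInt (fun x => f (x, c)) a b) (CInt (fun x => f (x, d)) a b)).
pose proof (Cmod_triangle_minus (CInt (fun x => f (b, x)) c d) (CInt (fun x => f (a, x)) c d)).
specialize (E1 c) as Ec. specialize (E1 d) as Ed.
specialize (E2 a) as Ea. specialize (E2 b) as Eb.
lra.
Qed.

Lemma rect_int_plus (f g : C -> C) (a b c d : R) : a <= b -> c <= d ->
  holo_rect f a b c d -> holo_rect g a b c d ->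
  rect_int (fun z => f z + g z)%C a b c d = (rect_int f a b c d + rect_int g a b c d)%C.
Proof.
intros H1 H2 Hf Hg. unfold rect_int.
assert (E1 : forall y, c <= y <= d -> CInt (fun x => f (x, y) + g (x, y))%C a b =
  (CInt (fun x => f (x, y)) a b + CInt (fun x => g (x, y)) a b)%C).
{ intros y Hy. apply (CInt_plus (fun x => f (x, y)) (fun x => g (x, y)));
  eapply ex_CInt_horizontal; eauto. }
assert (E2 : forall x, a <= x <= b -> CInt (fun y => f (x, y) + g (x, y))%C c d =
  (CInt (fun y => f (x, y)) c d + CInt (fun y => g (x, y)) c d)%C).
{ intros x Hx. apply (CInt_plus (fun y => f (x, y)) (fun y => g (x, y)));
  eapply ex_CInt_vertical; eauto. }
rewrite (E1 c), (E1 d), (E2 a), (E2 b) by lra. ring.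
Qed.

Lemma rect_int_affine (u v : C) (a b c d : R) : a <= b -> c <= d ->
  rect_int (fun z => u + v * z)%C a b c d = 0.
Proof.
intros H1 H2.
(* A complex primitive of the affine function: each side contributes a difference of its values at
   two corners, and these cancel around the contour. *)
set (F := fun z : C => (u * z + (1 / 2) * (v * (z * z)))%C).
assert (Hh : forall y, CInt (fun x => (u + v * (x, y))%C) a b = (F (b, y) - F (a, y))%C).
{ intros y. apply (CInt_antiderivative _ (fun x => F (x, y))); auto; unfold F;
  destruct u as [u1 u2], v as [v1 v2]; simpl; intros x.
  - auto_derive; auto. field.
  - auto_derive; auto. field.
  - apply (@ex_derive_continuous R_AbsRing R_NormedModule). auto_derive; auto.
  - apply (@ex_derive_continuous R_AbsRing R_NormedModule). auto_derive; auto. }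
assert (Hv : forall x, (Ci * CInt (fun y => u + v * (x, y)) c d)%C = (F (x, d) - F (x, c))%C).
{ intros x.
  (* The derivative of [F] in [y] is [i] times the integrand, so the real-variable primitive on a
     vertical side is [- i F]. *)
  destruct (CInt_antiderivative (fun y => (u + v * (x, y))%C) (fun y => (- Ci * F (x, y))%C) c d)
    as [_ E]; auto;
    try (unfold F; destruct u as [u1 u2], v as [v1 v2]; simpl; intros y).
  - auto_derive; auto. field.
  - auto_derive; auto. field.
  - apply (@ex_derive_continuous R_AbsRing R_NormedModule). auto_derive; auto.
  - apply (@ex_derive_continuous R_AbsRing R_NormedModule). auto_derive; auto.
  - rewrite E. generalize (F (x, d)), (F (x, c)). intros [p1 p2] [q1 q2].
    unfold Cmult, Cminus, Cplus, Copp, Ci; simpl. f_equal; ring. }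
unfold rect_int.
replace (Ci * _)%C with (Ci * CInt (fun y => u + v * (b, y)) c d
   - Ci * CInt (fun y => u + v * (a, y)) c d)%C by ring.
rewrite !Hh, !Hv. ring.
Qed.

Lemma rect_int_ext (f g : C -> C) (a b c d : R) : a <= b -> c <= d ->
  (forall z, f z = g z) -> rect_int f a b c d = rect_int g a b c d.
Proof.
intros H1 H2 H. unfold rect_int.
assert (Eh : forall y, CInt (fun x => f (x, y)) a b = CInt (fun x => g (x, y)) a b)
  by (intros; apply CInt_ext; auto).
assert (Ev : forall x, CInt (fun y => f (x, y)) c d = CInt (fun y => g (x, y)) c d)
  by (intros; apply CInt_ext; auto).
rewrite !Eh, !Ev. reflexivity.
Qed.

(** The intervals [[x n, x n + A / 2^n]] are nested, so every left end lies below every right end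
    ([Cross]), and the supremum of the left ends lies in all of them. *)
Lemma nested_dyadic (x : nat -> R) (A : R) : 0 <= A ->
  (forall n, x n <= x (S n) <= x n + A / 2 ^ S n) ->
  exists l, forall n, x n <= l <= x n + A / 2 ^ n.
Proof.
intros HA H.
assert (P : forall n, 0 < 2 ^ n) by (intros; apply pow_lt; lra).
assert (Hs : forall n, A / 2 ^ n = 2 * (A / 2 ^ S n)).
{ intros n. simpl. field. apply Rgt_not_eq, P. }
assert (HA' : forall n, 0 <= A / 2 ^ n)
  by (intros n; apply Rdiv_le_0_compat; [exact HA|apply P]).
assert (Inc : forall n k, x n <= x (k + n)%nat).
{ intros n k. induction k as [|k IH]; [simpl; lra|].
  simpl. destruct (H (k + n)%nat). lra. }
assert (Dec : forall n k, x (k + n)%nat + A / 2 ^ (k + n) <= x n + A / 2 ^ n).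
{ intros n k. induction k as [|k IH]; [simpl; lra|].
  specialize (Hs (k + n)%nat). destruct (H (k + n)%nat). simpl Nat.add. lra. }
assert (Cross : forall n m, x n <= x m + A / 2 ^ m).
{ intros n m. destruct (Nat.le_ge_cases n m) as [L|L].
  - replace m with ((m - n) + n)%nat by lia.
    apply Rle_trans with (1 := Inc n (m - n)%nat).
    specialize (HA' (m - n + n)%nat). lra.
  - replace n with ((n - m) + m)%nat by lia.
    specialize (Dec m (n - m)%nat). specialize (HA' (n - m + m)%nat). lra. }
destruct (completeness (fun r => exists n, r = x n)) as [l [U L]].
- exists (x O + A / 2 ^ 0). intros r [n ->]. apply Cross.
- exists (x O). exists O. reflexivity.
- exists l. intros n. split.
  + apply U. exists n. reflexivity.
  + apply L. intros r [m ->]. apply Cross.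
Qed.

(** The integrals over the four quarters add up to the whole one, so they cannot all have modulus at
    most [e]. *)
Lemma rect_int_quarter (f : C -> C) (x y A B e : R) : 0 <= A -> 0 <= B ->
  holo_rect f x (x + A) y (y + B) ->
  4 * e < Cmod (rect_int f x (x + A) y (y + B)) ->
  exists x' y', x <= x' <= x + A / 2 /\ y <= y' <= y + B / 2 /\
    e < Cmod (rect_int f x' (x' + A / 2) y' (y' + B / 2)).
Proof.
intros HA HB H He.
assert (Hl : holo_rect f x (x + A / 2) y (y + B)) by (eapply holo_rect_sub; [..|exact H]; lra).
assert (Hr : holo_rect f (x + A / 2) (x + A) y (y + B))
  by (eapply holo_rect_sub; [..|exact H]; lra).
rewrite (rect_int_split_x f x (x + A / 2)) in He by (auto; lra).
rewrite (rect_int_split_y f x (x + A / 2) y (y + B / 2)) in He by (auto; lra).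
rewrite (rect_int_split_y f (x + A / 2) (x + A) y (y + B / 2)) in He by (auto; lra).
set (I1 := rect_int f x (x + A / 2) y (y + B / 2)) in *.
set (I2 := rect_int f x (x + A / 2) (y + B / 2) (y + B)) in *.
set (I3 := rect_int f (x + A / 2) (x + A) y (y + B / 2)) in *.
set (I4 := rect_int f (x + A / 2) (x + A) (y + B / 2) (y + B)) in *.
assert (T : 4 * e < Cmod I1 + Cmod I2 + (Cmod I3 + Cmod I4)).
{ apply Rlt_le_trans with (1 := He).
  eapply Rle_trans; [apply Cmod_triangle|].
  apply Rplus_le_compat; apply Cmod_triangle. }
assert (EA : x + A / 2 + A / 2 = x + A) by field.
assert (EB : y + B / 2 + B / 2 = y + B) by field.
destruct (Rlt_dec e (Cmod I1)); [exists x, y; repeat split; auto; lra|].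
destruct (Rlt_dec e (Cmod I2));
  [exists x, (y + B / 2); rewrite EB; repeat split; auto; lra|].
destruct (Rlt_dec e (Cmod I3));
  [exists (x + A / 2), y; rewrite EA; repeat split; auto; lra|].
exists (x + A / 2), (y + B / 2). rewrite EA, EB. repeat split; try lra.
fold I4. lra.
Qed.

(** The affine part of [f] at [z] integrates to [0]; what remains is at most [eps (A + B)] on a
    boundary of length [2 (A + B)]. *)
Lemma rect_int_small (f : C -> C) (z : C) (eps : R) : 0 < eps -> holo f z ->
  exists del, 0 < del /\ forall x y A B, 0 <= A -> 0 <= B -> A + B < del ->
    x <= fst z <= x + A -> y <= snd z <= y + B -> holo_rect f x (x + A) y (y + B) ->
    Cmod (rect_int f x (x + A) y (y + B)) <= 2 * eps * (A + B) ^ 2.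
Proof.
intros Heps [l Hl]. destruct (Hl eps Heps) as [d [Hd Hloc]]. exists d. split; [exact Hd|].
intros x y A B HA HB HAB Hx Hy H.
set (g := fun w => (((f z - l * z) + l * w)%C)).
set (r := fun w => (f w + (-(1)) * g w)%C).
assert (Hg : holo_rect g x (x + A) y (y + B)).
{ intros u v _ _. unfold g. apply holo_plus; [apply holo_const|apply holo_scal, holo_id]. }
assert (Hr : holo_rect r x (x + A) y (y + B)).
{ intros u v Hu Hv. unfold r. apply holo_plus; [apply H; assumption|].
  apply holo_scal, Hg; assumption. }
assert (E : rect_int f x (x + A) y (y + B) = rect_int r x (x + A) y (y + B)).
{ transitivity (rect_int (fun w => r w + g w)%C x (x + A) y (y + B)).
  - apply rect_int_ext; try lra. intros w. unfold r. ring.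
  - rewrite rect_int_plus by (auto; lra).
    unfold g. rewrite rect_int_affine by lra. ring. }
rewrite E.
apply Rle_trans with (2 * ((x + A - x) + (y + B - y)) * (eps * (A + B)));
  [|right; ring].
apply Cmod_rect_int_le; auto; try lra.
intros u v Hu Hv.
assert (W : Cmod ((u, v) - z) <= A + B).
{ eapply Rle_trans; [apply Cmod_le_abs|]. destruct z as [z1 z2]; simpl in *.
  apply Rplus_le_compat; apply Rabs_le; lra. }
replace (r (u, v)) with (f (u, v) - f z - l * ((u, v) - z))%C by (unfold r, g; ring).
eapply Rle_trans; [apply Hloc; lra|]. apply Rmult_le_compat_l; lra.
Qed.

Theorem goursat (f : C -> C) (a b c d : R) : a <= b -> c <= d ->
  holo_rect f a b c d -> rect_int f a b c d = 0.
Proof.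
intros Hab Hcd H.
destruct (Req_dec (Cmod (rect_int f a b c d)) 0) as [E|E]; [apply Cmod_eq_0, E|exfalso].
(* Half of the modulus, so that the strict invariant in [P] holds at [n = 0]. *)
set (e := Cmod (rect_int f a b c d) / 2).
assert (He : 0 < e) by (pose proof (Cmod_ge_0 (rect_int f a b c d)); unfold e; lra).
set (A := b - a). set (B := d - c).
assert (HA : 0 <= A) by (unfold A; lra). assert (HB : 0 <= B) by (unfold B; lra).
assert (P2 : forall n, 0 < 2 ^ n) by (intros; apply pow_lt; lra).
assert (P4 : forall n, 0 < 4 ^ n) by (intros; apply pow_lt; lra).
assert (HAn : forall n, 0 <= A / 2 ^ n) by (intros; apply Rdiv_le_0_compat; auto).
assert (HBn : forall n, 0 <= B / 2 ^ n) by (intros; apply Rdiv_le_0_compat; auto).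
set (P := fun n (p : R * R) =>
  holo_rect f (fst p) (fst p + A / 2 ^ n) (snd p) (snd p + B / 2 ^ n) /\
  e / 4 ^ n < Cmod (rect_int f (fst p) (fst p + A / 2 ^ n) (snd p) (snd p + B / 2 ^ n))).
(* The hypothesis [P n p] stands inside the existential so that choice yields a total function
   [next], which can be iterated without carrying proofs. *)
assert (Step : forall n p, exists q, P n p -> P (S n) q /\
  fst p <= fst q <= fst p + A / 2 ^ S n /\ snd p <= snd q <= snd p + B / 2 ^ S n).
{ intros n [x y]. destruct (excluded_middle_informative (P n (x, y))) as [[Hh Hp]|N].
  2:{ exists (x, y). intros; contradiction. }
  simpl in Hh, Hp.
  destruct (rect_int_quarter f x y (A / 2 ^ n) (B / 2 ^ n) (e / 4 ^ S n))
    as [x' [y' [Hx [Hy Hq]]]]; auto.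
  { replace (4 * (e / 4 ^ S n)) with (e / 4 ^ n); [exact Hp|].
    simpl. field. apply Rgt_not_eq, P4. }
  assert (EA : A / 2 ^ n / 2 = A / 2 ^ S n) by (simpl; field; apply Rgt_not_eq, P2).
  assert (EB : B / 2 ^ n / 2 = B / 2 ^ S n) by (simpl; field; apply Rgt_not_eq, P2).
  rewrite EA, EB in *. exists (x', y'). intros _. unfold P; simpl fst; simpl snd.
  repeat split; try lra.
  eapply holo_rect_sub; [..|exact Hh]; try lra. }
set (next := fun n p => proj1_sig (constructive_indefinite_description _ (Step n p))).
set (s := fix s n := match n with O => (a, c) | S n => next n (s n) end).
assert (Ps : forall n, P n (s n)).
{ induction n as [|n IH].
  - unfold P; simpl. unfold Rdiv. rewrite Rinv_1, !Rmult_1_r.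
    replace (a + A) with b by (unfold A; ring). replace (c + B) with d by (unfold B; ring).
    split; [exact H|]. unfold e in *. lra.
  - simpl. unfold next.
    apply (proj2_sig (constructive_indefinite_description _ (Step n (s n))) IH). }
assert (Ss : forall n, fst (s n) <= fst (s (S n)) <= fst (s n) + A / 2 ^ S n /\
   snd (s n) <= snd (s (S n)) <= snd (s n) + B / 2 ^ S n).
{ intros n. change (s (S n)) with (next n (s n)). unfold next.
  apply (proj2_sig (constructive_indefinite_description _ (Step n (s n))) (Ps n)). }
destruct (nested_dyadic (fun n => fst (s n)) A HA (fun n => proj1 (Ss n))) as [zx Hzx].
destruct (nested_dyadic (fun n => snd (s n)) B HB (fun n => proj2 (Ss n))) as [zy Hzy].
assert (Hz : holo f (zx, zy)).
{ apply (proj1 (Ps O)); simpl.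
  - specialize (Hzx O); simpl in Hzx; lra.
  - specialize (Hzy O); simpl in Hzy; lra. }
(* Both sides of the final inequality carry the factor [4^-n], so the contradiction only needs
   [2 eps (A + B)^2 < e]. The [+ 1] covers a rectangle reduced to a point. *)
set (eps := e / (2 * ((A + B) ^ 2 + 1))).
assert (HS : 0 <= (A + B) ^ 2) by apply pow2_ge_0.
assert (Heps : 0 < eps) by (apply Rdiv_lt_0_compat; lra).
destruct (rect_int_small f (zx, zy) eps Heps Hz) as [del [Hdel K]].
destruct (pow_lt_1_zero (1 / 2)) with (y := del / (A + B + 1)) as [n Hn].
{ rewrite Rabs_pos_eq; lra. }
{ apply Rdiv_lt_0_compat; lra. }
specialize (Hn n (Nat.le_refl n)).
assert (Ehalf : (1 / 2) ^ n = / 2 ^ n).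
{ unfold Rdiv. rewrite Rmult_1_l, pow_inv. reflexivity. }
rewrite Ehalf, Rabs_pos_eq in Hn by (left; apply Rinv_0_lt_compat, P2).
destruct (Ps n) as [Hh Hlt].
assert (Hle : e / 4 ^ n < 2 * eps * (A / 2 ^ n + B / 2 ^ n) ^ 2).
{ apply Rlt_le_trans with (1 := Hlt). apply K; auto.
  - replace (A / 2 ^ n + B / 2 ^ n) with ((A + B) * / 2 ^ n) by (field; apply Rgt_not_eq, P2).
    apply Rle_lt_trans with ((A + B + 1) * / 2 ^ n).
    + apply Rmult_le_compat_r; [left; apply Rinv_0_lt_compat, P2|lra].
    + replace del with ((A + B + 1) * (del / (A + B + 1))) by (field; lra).
      apply Rmult_lt_compat_l; lra. }
assert (E4 : 2 ^ n * 2 ^ n = 4 ^ n).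
{ rewrite <- Rpow_mult_distr. f_equal; ring. }
replace (2 * eps * (A / 2 ^ n + B / 2 ^ n) ^ 2) with
  (2 * eps * (A + B) ^ 2 / 4 ^ n) in Hle
  by (rewrite <- E4; field; apply Rgt_not_eq, P2).
apply (Rmult_lt_compat_r (4 ^ n)) in Hle; [|apply P4].
unfold Rdiv in Hle. rewrite !Rmult_assoc, Rinv_l, !Rmult_1_r in Hle by (apply Rgt_not_eq, P4).
assert (2 * eps * ((A + B) ^ 2 + 1) = e) by (unfold eps; field; lra).
nra.
Qed.

(** * Gaussian means and analytic continuation *)

Definition gauss_int (f : C -> C) (a t h K : R) : C :=
  CInt (fun y => RtoC (exp (- K * (y - t) ^ 2)) * f (a, y))%C (t - h) (t + h).

Definition gauss_mass (t h K : R) : R :=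
  RInt (fun y => exp (- K * (y - t) ^ 2)) (t - h) (t + h).

(** An entire function that restricts to the real Gaussian on the line [Re z = a]; its modulus is
    [exp (K ((x - a)^2 - (y - t)^2))], small wherever the vertical distance to [(a, t)] exceeds the
    horizontal one. *)
Definition gauss_kernel (a t K : R) (z : C) : C :=
  cexp (K * ((z - (a, t)) * (z - (a, t)))).

Lemma holo_gauss_kernel (a t K : R) (z : C) : holo (gauss_kernel a t K) z.
Proof.
unfold gauss_kernel.
apply (holo_comp cexp (fun w => K * ((w - (a, t)) * (w - (a, t))))%C); [|apply holo_cexp].
apply holo_scal. apply (holo_comp (fun u => u * u)%C (fun w => w - (a, t))%C).
- apply holo_plus; [apply holo_id|apply holo_const].
- apply holo_sqr.
Qed.

Lemma Cmod_gauss_kernel (a t K x y : R) :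
  Cmod (gauss_kernel a t K (x, y)) = exp (K * ((x - a) ^ 2 - (y - t) ^ 2)).
Proof. unfold gauss_kernel. rewrite Cmod_cexp. f_equal. simpl. ring. Qed.

Lemma gauss_kernel_axis (a t K y : R) :
  gauss_kernel a t K (a, y) = RtoC (exp (- K * (y - t) ^ 2)).
Proof.
unfold gauss_kernel, cexp, RtoC, Cmult, Cminus, Cplus, Copp; simpl.
replace (a + - a) with 0 by ring.
replace (K * (0 * (y + - t) + (y + - t) * 0) + 0 * (0 * 0 - (y + - t) * (y + - t))) with 0 by ring.
rewrite cos_0, sin_0. f_equal; [|ring]. rewrite Rmult_1_r. f_equal. ring.
Qed.

Lemma ex_gauss_mass (t h K : R) : 0 <= h ->
  ex_RInt (fun y => exp (- K * (y - t) ^ 2)) (t - h) (t + h).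
Proof.
intros Hh. apply (ex_RInt_continuous (V := R_CompleteNormedModule)). intros z _.
apply (@ex_derive_continuous R_AbsRing R_NormedModule). auto_derive; auto.
Qed.

Lemma ex_gauss_int (f : C -> C) (a b t h K : R) : 0 <= h -> a <= b ->
  holo_rect f a b (t - h) (t + h) ->
  ex_CInt (fun y => RtoC (exp (- K * (y - t) ^ 2)) * f (a, y))%C (t - h) (t + h).
Proof.
intros Hh Hab H.
assert (G : holo_rect (fun z => gauss_kernel a t K z * f z)%C a b (t - h) (t + h)).
{ intros x y Hx Hy. apply holo_mult; [apply holo_gauss_kernel|apply H; assumption]. }
assert (E : ex_CInt (fun y => gauss_kernel a t K (a, y) * f (a, y))%C (t - h) (t + h)).
{ apply (ex_CInt_vertical (fun z => gauss_kernel a t K z * f z)%C a b); auto; lra. }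
destruct E as [E1 E2]. split.
- eapply ex_RInt_ext; [|exact E1]. intros y _; cbv beta; rewrite gauss_kernel_axis; reflexivity.
- eapply ex_RInt_ext; [|exact E2]. intros y _; cbv beta; rewrite gauss_kernel_axis; reflexivity.
Qed.

(* The other three sides of the rectangle carry a Gaussian that is exponentially small,
   except for the right-hand one, where [f] itself is assumed small. *)
Lemma Cmod_gauss_int_le (f : C -> C) (a t p h K M e : R) :
  0 <= p -> 0 <= h -> 0 <= K -> 0 <= M -> 0 <= e ->
  holo_rect f a (a + p) (t - h) (t + h) ->
  (forall x, a <= x <= a + p -> Cmod (f (x, t - h)) <= M) ->
  (forall x, a <= x <= a + p -> Cmod (f (x, t + h)) <= M) ->
  (forall y, t - h <= y <= t + h -> Cmod (f (a + p, y)) <= e) ->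
  Cmod (gauss_int f a t h K) <=
    2 * h * e * exp (K * p ^ 2) + 2 * p * M * exp (K * (p ^ 2 - h ^ 2)).
Proof.
intros Hp Hh HK HM He H Hb Ht Hr.
set (g := fun z => (gauss_kernel a t K z * f z)%C).
assert (G : holo_rect g a (a + p) (t - h) (t + h)).
{ intros x y Hx Hy. apply holo_mult; [apply holo_gauss_kernel|apply H; assumption]. }
assert (E : gauss_int f a t h K = CInt (fun y => g (a, y)) (t - h) (t + h)).
{ apply CInt_ext; [lra|]. intros y _. unfold g. rewrite gauss_kernel_axis. reflexivity. }
pose proof (goursat g a (a + p) (t - h) (t + h) ltac:(lra) ltac:(lra) G) as Z.
unfold rect_int in Z. rewrite <- E in Z.
set (I1 := CInt (fun x => g (x, t - h)) a (a + p)) in *.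
set (I2 := CInt (fun x => g (x, t + h)) a (a + p)) in *.
set (I3 := CInt (fun y => g (a + p, y)) (t - h) (t + h)) in *.
assert (E' : (Ci * gauss_int f a t h K = I1 - I2 + Ci * I3)%C).
{ transitivity (Ci * gauss_int f a t h K + 0)%C; [ring|]. rewrite <- Z. ring. }
rewrite <- (Rmult_1_l (Cmod (gauss_int f a t h K))), <- Cmod_Ci, <- Cmod_mult, E'.
assert (Hor : forall s, (s = t - h \/ s = t + h) ->
   Cmod (CInt (fun x => g (x, s)) a (a + p)) <= p * (M * exp (K * (p ^ 2 - h ^ 2)))).
{ intros s Hs. replace p with (a + p - a) at 2 by ring. apply Cmod_CInt_le_const; [lra| |].
  - apply (ex_CInt_horizontal g a (a + p) (t - h) (t + h)); auto; destruct Hs; subst; lra.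
  - intros x Hx. unfold g. rewrite Cmod_mult, Cmod_gauss_kernel, Rmult_comm.
    apply Rmult_le_compat; [apply Cmod_ge_0|left; apply exp_pos| |].
    + destruct Hs; subst; [apply Hb|apply Ht]; lra.
    + assert (L : K * ((x - a) ^ 2 - (s - t) ^ 2) <= K * (p ^ 2 - h ^ 2)).
      { apply Rmult_le_compat_l; [exact HK|].
        replace ((s - t) ^ 2) with (h ^ 2) by (destruct Hs; subst; ring).
        assert ((x - a) ^ 2 <= p ^ 2) by (apply pow_incr; lra). lra. }
      destruct L as [L|L]; [left; apply exp_increasing, L|right; f_equal; exact L]. }
assert (V : Cmod I3 <= (t + h - (t - h)) * (e * exp (K * p ^ 2))).
{ apply Cmod_CInt_le_const; [lra| |].
  - apply (ex_CInt_vertical g a (a + p) (t - h) (t + h)); auto; lra.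
  - intros y Hy. unfold g. rewrite Cmod_mult, Cmod_gauss_kernel, Rmult_comm.
    apply Rmult_le_compat; [apply Cmod_ge_0|left; apply exp_pos|apply Hr; lra|].
    assert (L : K * ((a + p - a) ^ 2 - (y - t) ^ 2) <= K * p ^ 2).
    { apply Rmult_le_compat_l; [exact HK|].
      replace (a + p - a) with p by ring. pose proof (pow2_ge_0 (y - t)). lra. }
    destruct L as [L|L]; [left; apply exp_increasing, L|right; f_equal; exact L]. }
pose proof (Hor (t - h) (or_introl eq_refl)). pose proof (Hor (t + h) (or_intror eq_refl)).
fold I1 in H0. fold I2 in H1.
eapply Rle_trans; [apply Cmod_triangle|]. rewrite Cmod_mult, Cmod_Ci, Rmult_1_l.
pose proof (Cmod_triangle_minus I1 I2). lra.
Qed.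

(** On [|y - t| <= 1 / k], an interval within [h] of [t], the exponent is at least [-1]. With
    [K = k^2] the mass thus decays no faster than [1 / k], which every [exp (- K c)] with [c > 0]
    eventually undercuts. *)
Lemma gauss_mass_lower (t h k : R) : 0 < k -> 1 <= k * h ->
  2 * exp (- 1) / k <= gauss_mass t h (k ^ 2).
Proof.
intros Hk Hkh.
assert (Hh : / k <= h).
{ apply (Rmult_le_reg_l k); [exact Hk|]. rewrite Rinv_r; lra. }
assert (Hk' : 0 < / k) by (apply Rinv_0_lt_compat, Hk).
pose proof (ex_gauss_mass t h (k ^ 2) ltac:(lra)) as I.
set (g := fun y => exp (- k ^ 2 * (y - t) ^ 2)) in *.
assert (I1 : ex_RInt g (t - h) (t + / k))
  by (apply (ex_RInt_Chasles_1 (V := R_CompleteNormedModule) g _ _ (t + h)); auto; lra).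
assert (I2 : ex_RInt g (t - / k) (t + / k))
  by (apply (ex_RInt_Chasles_2 (V := R_CompleteNormedModule) g (t - h)); auto; lra).
assert (I3 : ex_RInt g (t - h) (t - / k))
  by (apply (ex_RInt_Chasles_1 (V := R_CompleteNormedModule) g _ _ (t + / k)); auto; lra).
assert (I4 : ex_RInt g (t + / k) (t + h))
  by (apply (ex_RInt_Chasles_2 (V := R_CompleteNormedModule) g (t - h)); auto; lra).
unfold gauss_mass. fold g.
rewrite <- (RInt_Chasles (V := R_CompleteNormedModule) g (t - h) (t + / k) (t + h) I1 I4).
rewrite <- (RInt_Chasles (V := R_CompleteNormedModule) g (t - h) (t - / k) (t + / k) I3 I2).
change (2 * exp (-1) / k <= RInt g (t - h) (t - / k) + RInt g (t - / k) (t + / k)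
  + RInt g (t + / k) (t + h)).
assert (P3 : 0 <= RInt g (t - h) (t - / k)).
{ apply RInt_ge_0; auto; try lra. intros; left; apply exp_pos. }
assert (P4 : 0 <= RInt g (t + / k) (t + h)).
{ apply RInt_ge_0; auto; try lra. intros; left; apply exp_pos. }
assert (P2 : (t + / k - (t - / k)) * exp (-1) <= RInt g (t - / k) (t + / k)).
{ rewrite <- (RInt_const (t - / k) (t + / k) (exp (-1)) : _ = _ * _).
  apply RInt_le; auto; [lra|apply ex_RInt_const|]. intros y Hy. unfold g.
  assert (L : -1 <= - k ^ 2 * (y - t) ^ 2).
  { assert (E : (k * (y - t)) ^ 2 <= 1).
    { rewrite <- (pow2_abs (k * (y - t))), Rabs_mult, (Rabs_pos_eq k) by lra.
      assert (A : Rabs (y - t) <= / k) by (apply Rabs_le; lra).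
      assert (0 <= k * Rabs (y - t) <= 1).
      { pose proof (Rabs_pos (y - t)). split; [nra|].
        apply (Rmult_le_compat_l k) in A; [|lra]. rewrite Rinv_r in A; lra. }
      nra. }
    rewrite Rpow_mult_distr in E. lra. }
  destruct L as [L|L]; [left; apply exp_increasing, L|right; f_equal; exact L]. }
unfold Rdiv. lra.
Qed.

Lemma holo_path_bounded (f : C -> C) (p : R -> C) (a b : R) :
  (forall x, a <= x <= b -> holo f (p x)) ->
  (forall x y, Cmod (p y - p x) <= Rabs (y - x)) ->
  exists M, 0 <= M /\ forall x, a <= x <= b -> Cmod (f (p x)) <= M.
Proof.
intros H Hp.
assert (Hc : forall x, a <= x <= b -> continuous (fun y => fst (f (p y))) x /\
  continuous (fun y => snd (f (p y))) x)
  by (intros; apply holo_continuous_path; auto).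
destruct (@bounded_continuity R_AbsRing R_NormedModule (fun y => fst (f (p y))) a b)
  as [M1 H1]; [intros; apply Hc; assumption|].
destruct (@bounded_continuity R_AbsRing R_NormedModule (fun y => snd (f (p y))) a b)
  as [M2 H2]; [intros; apply Hc; assumption|].
exists (Rabs M1 + Rabs M2). split.
- pose proof (Rabs_pos M1); pose proof (Rabs_pos M2); lra.
- intros x Hx. eapply Rle_trans; [apply Cmod_le_abs|].
  specialize (H1 x Hx). specialize (H2 x Hx).
  change (Rabs (fst (f (p x))) < M1) in H1. change (Rabs (snd (f (p x))) < M2) in H2.
  pose proof (Rle_abs M1); pose proof (Rle_abs M2); lra.
Qed.

(* As [K] grows, the normalized Gaussian means of [f] tend to [f (a, t)]. *)
Lemma gauss_mean_bound (f : C -> C) (a b t h eps c D : R) :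
  0 < h -> a <= b -> 0 < c -> 0 <= D ->
  holo_rect f a b (t - h) (t + h) ->
  (forall K, 0 <= K ->
     Cmod (gauss_int f a t h K) <= eps * gauss_mass t h K + D * exp (- K * c)) ->
  Cmod (f (a, t)) <= eps.
Proof.
intros Hh Hab Hc HD H HK.
destruct (Rle_lt_dec (Cmod (f (a, t))) eps) as [L|L]; [exact L|exfalso].
(* One half of the excess over [eps] absorbs the oscillation of [f] near [t]; the other half remains
   to be contradicted. *)
set (eta := (Cmod (f (a, t)) - eps) / 2). assert (Heta : 0 < eta) by (unfold eta; lra).
destruct (holo_path_bounded f (fun y => (a, y)) (t - h) (t + h)) as [M [HM0 HM]].
{ intros y Hy. apply H; lra. }
{ intros; apply Cmod_vertical. }
destruct (H a t ltac:(lra) ltac:(lra)) as [l Hl].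
destruct (cdiff_local_lipschitz _ _ _ Hl) as [d1 [Hd1 Lip]].
pose proof (Cmod_ge_0 l) as Hl0.
set (d := Rmin d1 (eta / (Cmod l + 1))).
assert (Hd : 0 < d) by (apply Rmin_pos; [exact Hd1|apply Rdiv_lt_0_compat; lra]).
assert (Near : forall y, Rabs (y - t) < d -> Cmod (f (a, y) - f (a, t)) <= eta).
{ intros y Hy. pose proof (Cmod_vertical t y a) as V.
  eapply Rle_trans; [apply Lip|].
  - apply Rle_lt_trans with (1 := V). apply Rlt_le_trans with (1 := Hy), Rmin_l.
  - replace eta with ((Cmod l + 1) * (eta / (Cmod l + 1))) by (field; lra).
    apply Rmult_le_compat_l; [lra|].
    pose proof (Rmin_r d1 (eta / (Cmod l + 1))) as R. fold d in R. lra. }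
(* A common rate of decay for two errors: the given one, and the part of the Gaussian at distance at
   least [d] from [t], where [f] is merely bounded by [M]. *)
set (c' := Rmin c (d ^ 2)).
assert (Hc' : 0 < c') by (apply Rmin_pos; [exact Hc|apply pow_lt, Hd]).
set (D' := D + 2 * h * (2 * M)).
assert (HD' : 0 <= D') by (unfold D'; nra).
assert (Key : forall K, 0 <= K -> eta * gauss_mass t h K <= D' * exp (- K * c')).
{ intros K K0.
  pose proof (ex_gauss_mass t h K ltac:(lra)) as IG.
  pose proof (ex_gauss_int f a b t h K ltac:(lra) Hab H) as IF.
  set (g := fun y => exp (- K * (y - t) ^ 2)) in *.
  set (f0 := f (a, t)) in *.
  assert (IC : ex_CInt (fun y => RtoC (g y)) (t - h) (t + h)).
  { split; simpl; [exact IG|apply ex_RInt_const]. }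
  assert (EC : CInt (fun y => RtoC (g y)) (t - h) (t + h) = RtoC (gauss_mass t h K)).
  { unfold CInt, RtoC; simpl. f_equal. rewrite RInt_const. unfold scal; simpl.
    unfold mult; simpl. ring. }
  pose proof (ex_CInt_scal (- f0) _ _ _ IC) as IS.
  assert (B : Cmod (gauss_int f a t h K - f0 * gauss_mass t h K) <=
     eta * gauss_mass t h K + 2 * h * (2 * M) * exp (- K * c')).
  { replace (gauss_int f a t h K - f0 * gauss_mass t h K)%C with
      (CInt (fun y => RtoC (g y) * f (a, y) + - f0 * RtoC (g y))%C (t - h) (t + h)).
    2:{ rewrite (CInt_plus (fun y => RtoC (g y) * f (a, y))%C (fun y => - f0 * RtoC (g y))%C)
          by assumption.
        rewrite CInt_scal, EC by exact IC. unfold gauss_int, g. ring. }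
    eapply Rle_trans.
    { apply (Cmod_CInt_le _ (fun y => eta * g y + 2 * M * exp (- K * c'))); [lra| | |].
      - apply ex_CInt_plus; assumption.
      - apply ex_RInt_Rplus; [apply ex_RInt_Rmult, IG|apply ex_RInt_const].
      - intros y Hy.
        replace (RtoC (g y) * f (a, y) + - f0 * RtoC (g y))%C
          with (RtoC (g y) * (f (a, y) - f0))%C by ring.
        assert (G0 : 0 < g y) by apply exp_pos.
        rewrite Cmod_mult, Cmod_R, Rabs_pos_eq by lra.
        pose proof (exp_pos (- K * c')) as X0.
        destruct (Rlt_le_dec (Rabs (y - t)) d) as [Y|Y].
        + specialize (Near y Y). fold f0 in Near.
          apply Rle_trans with (g y * eta); [apply Rmult_le_compat_l; lra|]. nra.
        + assert (F1 : Cmod (f (a, y) - f0) <= 2 * M).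
          { eapply Rle_trans; [apply Cmod_triangle_minus|].
            pose proof (HM y ltac:(lra)). pose proof (HM t ltac:(lra)). unfold f0. lra. }
          assert (F2 : g y <= exp (- K * c')).
          { assert (L2 : - K * (y - t) ^ 2 <= - K * c').
            { assert (d ^ 2 <= (y - t) ^ 2).
              { rewrite <- (pow2_abs (y - t)). apply pow_incr. lra. }
              assert (c' <= d ^ 2) by apply Rmin_r. nra. }
            unfold g. destruct L2 as [L2|L2];
              [left; apply exp_increasing, L2|right; f_equal; exact L2]. }
          assert (g y * Cmod (f (a, y) - f0) <= exp (- K * c') * (2 * M)).
          { apply Rmult_le_compat; auto; [lra|apply Cmod_ge_0]. }
          nra. }
    rewrite RInt_Rplus; [|apply ex_RInt_Rmult, IG|apply ex_RInt_const].
    rewrite RInt_Rmult by exact IG. rewrite RInt_const.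
    unfold scal; simpl. unfold mult; simpl. fold (gauss_mass t h K).
    right. unfold gauss_mass, g. ring. }
  specialize (HK K K0).
  assert (G0 : 0 <= gauss_mass t h K).
  { apply RInt_ge_0; [lra|exact IG|]. intros; left; apply exp_pos. }
  assert (T : Cmod f0 * gauss_mass t h K <= Cmod (gauss_int f a t h K) +
     Cmod (gauss_int f a t h K - f0 * gauss_mass t h K)).
  { replace (Cmod f0 * gauss_mass t h K) with (Cmod (f0 * gauss_mass t h K))
      by (rewrite Cmod_mult, Cmod_R, Rabs_pos_eq; lra).
    pose proof (Cmod_triangle_minus (gauss_int f a t h K)
      (gauss_int f a t h K - f0 * gauss_mass t h K)) as T.
    replace (gauss_int f a t h K - (gauss_int f a t h K - f0 * gauss_mass t h K))%C
      with (f0 * gauss_mass t h K)%C in T by ring. exact T. }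
  assert (X : exp (- K * c) <= exp (- K * c')).
  { assert (c' <= c) by apply Rmin_l.
    assert (L2 : - K * c <= - K * c') by nra.
    destruct L2 as [L2|L2]; [left; apply exp_increasing, L2|right; f_equal; exact L2]. }
  assert (D * exp (- K * c) <= D * exp (- K * c')) by (apply Rmult_le_compat_l; assumption).
  assert (EE : Cmod f0 = eps + 2 * eta) by (unfold eta, f0; field).
  rewrite EE in T. unfold D'. lra. }
(* With [K = k^2], the inequality [exp (- z) <= 1 / z] turns [Key] into [k <= q]. Hence the choice
   of [k] above [q], and above [1 / h] for the lower bound on the mass. *)
set (q := D' * exp 1 / (2 * eta * c')).
assert (Hq : 0 <= q).
{ apply Rdiv_le_0_compat; [|nra]. apply Rmult_le_pos; [exact HD'|left; apply exp_pos]. }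
set (k := q + 1 + / h).
assert (Hih : 0 < / h) by (apply Rinv_0_lt_compat, Hh).
assert (Hk : 0 < k) by (unfold k; lra).
assert (Hkh : 1 <= k * h).
{ replace 1 with (/ h * h) by (field; lra).
  apply Rmult_le_compat_r; [lra|]. unfold k; lra. }
pose proof (gauss_mass_lower t h k Hk Hkh) as Low.
pose proof (Key (k ^ 2) (pow2_ge_0 k)) as Up.
assert (Ex : exp (- k ^ 2 * c') <= / (k ^ 2 * c')).
{ replace (- k ^ 2 * c') with (- (k ^ 2 * c')) by ring. rewrite exp_Ropp.
  apply Rinv_le_contravar; [apply Rmult_lt_0_compat; [apply pow_lt, Hk|exact Hc']|]. pose proof (exp_ineq1_le (k ^ 2 * c')). lra. }
assert (F : eta * (2 * exp (-1) / k) <= D' * / (k ^ 2 * c')).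
{ apply Rle_trans with (eta * gauss_mass t h (k ^ 2)); [apply Rmult_le_compat_l; lra|].
  apply Rle_trans with (1 := Up). apply Rmult_le_compat_l; lra. }
assert (E1 : exp (-1) * exp 1 = 1).
{ rewrite <- exp_plus. replace (-1 + 1) with 0 by ring. apply exp_0. }
apply (Rmult_le_compat_r (k ^ 2 * c' * exp 1)) in F.
2:{ apply Rmult_le_pos; [nra|left; apply exp_pos]. }
replace (eta * (2 * exp (-1) / k) * (k ^ 2 * c' * exp 1)) with
  (2 * eta * c' * k * (exp (-1) * exp 1)) in F by (field; lra).
replace (D' * / (k ^ 2 * c') * (k ^ 2 * c' * exp 1)) with (2 * eta * c' * q) in F
  by (unfold q; field; lra).
rewrite E1, Rmult_1_r in F.
assert (0 < 2 * eta * c') by nra.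
assert (k <= q) by (apply (Rmult_le_reg_l (2 * eta * c')); lra).
unfold k in *. lra.
Qed.

(** The approximants are known to be close to one another on the whole rectangle, but to [F] only on
    the right side. For fixed [K], the Gaussian integral of [F - S n] splits into those of [F - S m]
    and [S m - S n]. The latter is at most [e n] times the mass. In the former, letting [m] grow
    removes the right side, while the horizontal sides stay bounded independently of [m] and carry
    [exp (- K (h^2 - p^2))], which decays because [p < h]. *)
Theorem limit_identification (F : C -> C) (S : nat -> C -> C) (e : nat -> R)
    (N0 : nat) (a t p h : R) :
  0 < p < h ->
  holo_rect F a (a + p) (t - h) (t + h) ->
  (forall n, holo_rect (S n) a (a + p) (t - h) (t + h)) ->
  (forall n m, (N0 <= n <= m)%nat -> forall x y, a <= x <= a + p -> t - h <= y <= t + h ->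
     Cmod (S m (x, y) - S n (x, y)) <= e n) ->
  (forall eps, 0 < eps -> exists n0, forall n, (n0 <= n)%nat -> e n <= eps) ->
  (forall y eps, 0 < eps -> exists n0, forall n, (n0 <= n)%nat ->
     Cmod (F ((a + p)%R, y) - S n ((a + p)%R, y)) <= eps) ->
  forall n, (N0 <= n)%nat -> Cmod (F (a, t) - S n (a, t)) <= e n.
Proof.
intros Hph HF HS Hcau He Hlim n Hn.
assert (He0 : forall m, (N0 <= m)%nat -> 0 <= e m).
{ intros m Hm. eapply Rle_trans; [apply Cmod_ge_0|].
  apply (Hcau m m ltac:(lia) a t); lra. }
(* Pointwise convergence on the right side is enough: passing to the limit in the Cauchy bound makes
   it uniform in [y]. *)
assert (Hright : forall m, (N0 <= m)%nat -> forall y, t - h <= y <= t + h ->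
  Cmod (F ((a + p)%R, y) - S m ((a + p)%R, y)) <= e m).
{ intros m Hm y Hy. apply le_epsilon. intros eta Heta.
  destruct (Hlim y eta Heta) as [n0 Hn0].
  set (k := Nat.max m n0).
  replace (F ((a + p)%R, y) - S m ((a + p)%R, y))%C with
    ((S k ((a + p)%R, y) - S m ((a + p)%R, y)) + (F ((a + p)%R, y) - S k ((a + p)%R, y)))%C by ring.
  eapply Rle_trans; [apply Cmod_triangle|]. apply Rplus_le_compat.
  - apply Hcau; [lia|lra|lra].
  - apply Hn0. lia. }
set (f := fun m z => (F z + (-(1)) * S m z)%C).
assert (Hf : forall m, holo_rect (f m) a (a + p) (t - h) (t + h)).
{ intros m x y Hx Hy. apply holo_plus; [apply HF; assumption|].
  apply holo_scal, HS; assumption. }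
destruct (holo_path_bounded (f n) (fun x => (x, t - h)) a (a + p)) as [M1 [M1p HM1]].
{ intros x Hx. apply Hf; lra. } { intros; apply Cmod_horizontal. }
destruct (holo_path_bounded (f n) (fun x => (x, t + h)) a (a + p)) as [M2 [M2p HM2]].
{ intros x Hx. apply Hf; lra. } { intros; apply Cmod_horizontal. }
(* Bounds [F - S m] on both horizontal sides for all [m >= n] at once, through [F - S n] and the
   Cauchy bound. *)
set (M := M1 + M2 + e n).
assert (HM : 0 <= M) by (pose proof (He0 n Hn); unfold M; lra).
replace (F (a, t) - S n (a, t))%C with (f n (a, t)) by (unfold f; ring).
apply (gauss_mean_bound (f n) a (a + p) t h (e n) (h ^ 2 - p ^ 2) (2 * p * M));
  try lra; auto.
{ nra. } { nra. }
intros K HK. apply le_epsilon. intros eta Heta.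
destruct (He (eta / (2 * h * exp (K * p ^ 2)))) as [n1 Hn1].
{ apply Rdiv_lt_0_compat; [exact Heta|]. pose proof (exp_pos (K * p ^ 2)). nra. }
set (m := Nat.max n n1). specialize (Hn1 m ltac:(lia)).
assert (Hfm : Cmod (gauss_int (f m) a t h K) <= eta + 2 * p * M * exp (- K * (h ^ 2 - p ^ 2))).
{ assert (Hbd : forall x y, a <= x <= a + p -> t - h <= y <= t + h ->
    Cmod (f n (x, y)) <= M1 + M2 -> Cmod (f m (x, y)) <= M).
  { intros x y Hx Hy B.
    replace (f m (x, y)) with (f n (x, y) - (S m (x, y) - S n (x, y)))%C by (unfold f; ring).
    eapply Rle_trans; [apply Cmod_triangle_minus|]. unfold M.
    pose proof (Hcau n m ltac:(lia) x y Hx Hy). lra. }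
  eapply Rle_trans.
  - apply (Cmod_gauss_int_le (f m) a t p h K M (e m)); auto; try lra.
    + apply He0; lia.
    + intros x Hx. apply Hbd; try lra. specialize (HM1 x Hx). lra.
    + intros x Hx. apply Hbd; try lra. specialize (HM2 x Hx). lra.
    + intros y Hy. pose proof (Hright m ltac:(lia) y Hy) as R.
      replace (f m ((a + p)%R, y)) with (F ((a + p)%R, y) - S m ((a + p)%R, y))%C by (unfold f; ring).
      exact R.
  - apply Rplus_le_compat.
    + pose proof (exp_pos (K * p ^ 2)) as X.
      apply Rle_trans with (2 * h * (eta / (2 * h * exp (K * p ^ 2))) * exp (K * p ^ 2)).
      * apply Rmult_le_compat_r; [lra|]. apply Rmult_le_compat_l; lra.
      * right. field. split; lra.
    + right. f_equal. f_equal. ring. }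
pose proof (ex_gauss_int (f m) a (a + p) t h K ltac:(lra) ltac:(lra) (Hf m)) as I1.
set (d := fun z => (S m z + (-(1)) * S n z)%C).
assert (Hd : holo_rect d a (a + p) (t - h) (t + h)).
{ intros x y Hx Hy. apply holo_plus; [apply HS; assumption|].
  apply holo_scal, HS; assumption. }
pose proof (ex_gauss_int d a (a + p) t h K ltac:(lra) ltac:(lra) Hd) as I2.
assert (E : gauss_int (f n) a t h K = (gauss_int (f m) a t h K + gauss_int d a t h K)%C).
{ unfold gauss_int at 2 3. rewrite <- CInt_plus by assumption.
  apply CInt_ext; [lra|]. intros y _. unfold f, d. ring. }
rewrite E. eapply Rle_trans; [apply Cmod_triangle|].
assert (Hgd : Cmod (gauss_int d a t h K) <= e n * gauss_mass t h K).
{ pose proof (ex_gauss_mass t h K ltac:(lra)) as IG.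
  unfold gauss_mass. rewrite <- RInt_Rmult by exact IG.
  apply Cmod_CInt_le; [lra|exact I2|apply ex_RInt_Rmult, IG|].
  intros y Hy. pose proof (exp_pos (- K * (y - t) ^ 2)) as X.
  rewrite Cmod_mult, Cmod_R, Rabs_pos_eq, Rmult_comm by lra.
  apply Rmult_le_compat_r; [lra|].
  replace (d (a, y)) with (S m (a, y) - S n (a, y))%C by (unfold d; ring).
  apply Hcau; [lia|lra|lra]. }
lra.
Qed.

(** * Summation by parts for the Lerch series *)

Lemma exp_le (x y : R) : x <= y -> exp x <= exp y.
Proof. intros [H| ->]; [left; apply exp_increasing, H|right; reflexivity]. Qed.

Lemma ln_le_minus_1 (y : R) : 0 < y -> ln y <= y - 1.
Proof.
intros Hy. pose proof (exp_ineq1_le (ln y)) as H. rewrite exp_ln in H by exact Hy. lra.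
Qed.

Lemma ln_diff_upper (x : R) : 0 < x -> ln (x + 1) - ln x <= / x.
Proof.
intros Hx. rewrite <- ln_div by lra.
eapply Rle_trans; [apply ln_le_minus_1; apply Rdiv_lt_0_compat; lra|].
right. field. lra.
Qed.

Lemma ln_diff_lower (x : R) : 0 < x -> / (x + 1) <= ln (x + 1) - ln x.
Proof.
intros Hx.
pose proof (ln_le_minus_1 (x / (x + 1)) ltac:(apply Rdiv_lt_0_compat; lra)) as H.
rewrite ln_div in H by lra.
replace (x / (x + 1) - 1) with (- / (x + 1)) in H by (field; lra). lra.
Qed.

(** The second difference is the logarithm of [(x + 1)^2 / (x (x + 2))], a number exceeding [1] by
    [1 / (x (x + 2))]. It governs how fast the ratio of consecutive terms varies. *)
Lemma ln_second_diff (x : R) : 0 < x ->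
  0 <= (ln (x + 1) - ln x) - (ln (x + 1 + 1) - ln (x + 1)) <= / (x * (x + 1)).
Proof.
intros Hx. split.
- pose proof (ln_diff_upper (x + 1) ltac:(lra)). pose proof (ln_diff_lower x Hx). lra.
- replace (ln (x + 1) - ln x - (ln (x + 1 + 1) - ln (x + 1)))
    with (ln ((x + 1) * (x + 1) / (x * (x + 1 + 1)))).
  2:{ rewrite ln_div, !ln_mult by nra. ring. }
  eapply Rle_trans; [apply ln_le_minus_1; apply Rdiv_lt_0_compat; nra|].
  replace ((x + 1) * (x + 1) / (x * (x + 1 + 1)) - 1) with (/ (x * (x + 1 + 1)))
    by (field; lra).
  apply Rinv_le_contravar; nra.
Qed.

Lemma Rpower_neg_le (x y a : R) : 0 < x -> x <= y -> 0 <= a -> Rpower y (- a) <= Rpower x (- a).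
Proof.
intros Hx Hxy Ha. unfold Rpower. apply exp_le.
assert (ln x <= ln y) by (apply ln_le; assumption). nra.
Qed.

Lemma Rpower_neg_succ (x a : R) : 0 < x -> Rpower x (- (a + 1)) * x = Rpower x (- a).
Proof.
intros Hx. rewrite <- (Rpower_1 x) at 2 by exact Hx. rewrite <- Rpower_plus. f_equal. ring.
Qed.

(** The discrete counterpart of integrating [a z^(-a-1)] over [[x, x + 1]], drawn from
    [exp z >= 1 + z]. It supplies the decreasing potential for sums with exponent [a + 1]. *)
Lemma Rpower_neg_telescope (x a : R) : 0 < x -> 0 <= a ->
  a * Rpower (x + 1) (- (a + 1)) <= Rpower x (- a) - Rpower (x + 1) (- a).
Proof.
intros Hx Ha.
pose proof (ln_diff_lower x Hx) as L.
assert (E : Rpower x (- a) = Rpower (x + 1) (- a) * exp (a * (ln (x + 1) - ln x))).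
{ unfold Rpower. rewrite <- exp_plus. f_equal. ring. }
rewrite E, <- (Rpower_neg_succ (x + 1) a) by lra.
pose proof (exp_ineq1_le (a * (ln (x + 1) - ln x))) as X.
set (P := Rpower (x + 1) (- (a + 1))). assert (0 < P) by apply exp_pos.
assert (a * / (x + 1) <= a * (ln (x + 1) - ln x)) by (apply Rmult_le_compat_l; lra).
replace (a * P) with (P * (x + 1) * (a * / (x + 1))) by (field; lra).
rewrite <- (Rmult_1_r (P * (x + 1))) at 3. rewrite <- Rmult_minus_distr_l.
apply Rmult_le_compat_l; [nra|]. lra.
Qed.

(* Summation by parts: the potential [B] dominates the variation of [c]. *)
Lemma abel_bound (g c : nat -> C) (B : nat -> R) (N M : nat) : (N <= M)%nat ->
  (forall n, (N <= n)%nat -> g n = (c n * (g (S n) - g n))%C) ->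
  (forall n, (N <= n)%nat -> Cmod ((c (S n) - c n) * g (S n)) <= B n - B (S n)) ->
  Cmod (Csum g N M) + B M <=
    Cmod (c M * g (S M)) + Cmod (c N * g N) + B N.
Proof.
intros HNM Hg HB.
assert (K : Cmod (Csum g N M - c M * g (S M))%C + B M <=
  Cmod (c N * g N) + B N).
{ induction HNM as [|M HNM IH].
  - rewrite Csum_n_n.
    replace (g N - c N * g (S N))%C with (- (c N * g N))%C.
    + rewrite Cmod_opp. lra.
    + pose proof (Hg N (Nat.le_refl N)) as E.
      transitivity (c N * (g (S N) - g N) - c N * g (S N))%C; [ring|].
      rewrite <- E. reflexivity.
  - rewrite Csum_n_Sm by lia.
        replace (Csum g N M + g (S M) - c (S M) * g (S (S M)))%C with
      ((Csum g N M - c M * g (S M)) - ((c (S M) - c M) * g (S M)))%C.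
    + eapply Rle_trans; [apply Rplus_le_compat_r, Cmod_triangle_minus|].
      specialize (HB M HNM). lra.
    + pose proof (Hg (S M) ltac:(lia)) as E.
      transitivity (Csum g N M + c (S M) * (g (S (S M)) - g (S M)) - c (S M) * g (S (S M)))%C;
        [ring|].
      rewrite <- E. reflexivity. }
pose proof (Cmod_triangle (Csum g N M - c M * g (S M)) (c M * g (S M))) as T.
replace (Csum g N M - c M * g (S M) + c M * g (S M))%C
  with (Csum g N M) in T by ring.
lra.
Qed.

Lemma Cmod_cpow_pos (x : R) (s : C) : Cmod (cpow_pos x s) = Rpower x (Re s).
Proof.
unfold cpow_pos. rewrite Cmod_cexp. unfold Rpower. f_equal.
destruct s; simpl. ring.
Qed.

Lemma Cmod_phase (y : R) : Cmod (cexp (0, y)) = 1.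
Proof. rewrite Cmod_cexp. apply exp_0. Qed.

Lemma Cmod_lerch_term (v lam : R) (s : C) (n : nat) :
  Cmod (lerch_term v lam s n) = Rpower (INR n + v) (- Re s).
Proof.
unfold lerch_term. rewrite Cmod_mult, Cmod_phase, Rmult_1_l. apply Cmod_cpow_pos.
Qed.

(** With [x = n + alpha], the quotient of consecutive terms of the series:
    [exp (2 pi i lambda) (1 + 1 / x)^(-s)]. *)
Definition lerch_ratio (lam : R) (s : C) (x : R) : C :=
  (cexp (0, (2 * PI * lam)%R) * cexp (- s * RtoC (ln (x + 1) - ln x)))%C.

Lemma lerch_term_succ (v lam : R) (s : C) (n : nat) :
  lerch_term v lam s (S n) = (lerch_ratio lam s (INR n + v) * lerch_term v lam s n)%C.
Proof.
unfold lerch_ratio, lerch_term, cpow_pos. rewrite <- !cexp_plus. f_equal.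
rewrite S_INR. replace (INR n + 1 + v) with (INR n + v + 1) by ring.
apply injective_projections; simpl; ring.
Qed.

(** Both exponents lie in the closed left half-plane, where [cexp] is [1]-Lipschitz, and they differ
    by [s] times a second difference of the logarithm. *)
Lemma lerch_ratio_variation (lam : R) (s : C) (x : R) : 0 <= Re s -> 0 < x ->
  Cmod (lerch_ratio lam s (x + 1) - lerch_ratio lam s x) <= Cmod s / (x * (x + 1)).
Proof.
intros Hs Hx. unfold lerch_ratio.
set (u := ln (x + 1 + 1) - ln (x + 1)). set (w := ln (x + 1) - ln x).
assert (Hu : 0 <= u).
{ pose proof (ln_diff_lower (x + 1) ltac:(lra)).
  assert (0 < / (x + 1 + 1)) by (apply Rinv_0_lt_compat; lra). unfold u; lra. }
pose proof (ln_second_diff x Hx) as D. fold u w in D.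
replace (cexp (0, (2 * PI * lam)%R) * cexp (- s * u) - cexp (0, (2 * PI * lam)%R) * cexp (- s * w))%C
  with (cexp (0, (2 * PI * lam)%R) * (cexp (- s * u) - cexp (- s * w)))%C by ring.
rewrite Cmod_mult, Cmod_phase, Rmult_1_l.
eapply Rle_trans; [apply (cexp_lipschitz _ _ 0)|].
- destruct s; simpl in *; nra.
- destruct s; simpl in *; nra.
- rewrite exp_0, Rmult_1_l.
  replace (- s * u - - s * w)%C with (s * RtoC (w - u))%C by (rewrite RtoC_minus; ring).
  rewrite Cmod_mult, Cmod_R, Rabs_pos_eq by lra.
  apply Rmult_le_compat_l; [apply Cmod_ge_0|lra].
Qed.

(** If [r n] is the ratio, a term is [c n = 1 / (r n - 1)] times its forward difference, and
    [c (n + 1) - c n] is minus [c n c (n + 1) (r (n + 1) - r n)]. So [D] bounds the coefficients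
    [c], and [B] absorbs their variation. *)
Lemma lerch_sum_abel (v lam : R) (s : C) (N M : nat) (D B : nat -> R) :
  0 < v -> 0 <= Re s -> (N <= M)%nat ->
  (forall n, (N <= n)%nat -> 0 < D n /\
     / D n <= Cmod (lerch_ratio lam s (INR n + v) - 1)) ->
  (forall n, (N <= n)%nat -> 0 <= B n /\
     D n * D (S n) * (Cmod s / ((INR n + v) * (INR (S n) + v)))
       * Rpower (INR (S n) + v) (- Re s) <= B n - B (S n)) ->
  Cmod (Csum (lerch_term v lam s) N M) <=
    D M * Rpower (INR (S M) + v) (- Re s) + D N * Rpower (INR N + v) (- Re s) + B N.
Proof.
intros Hv Hs HNM HD HB.
set (g := lerch_term v lam s). set (r := fun n => lerch_ratio lam s (INR n + v)).
set (c := fun n => (/ (r n - 1))%C).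
assert (Hr : forall n, (N <= n)%nat -> (r n - 1)%C <> 0).
{ intros n Hn. apply Cmod_gt_0. destruct (HD n Hn) as [H1 H2].
  apply Rlt_le_trans with (2 := H2), Rinv_0_lt_compat, H1. }
assert (Hc : forall n, (N <= n)%nat -> Cmod (c n) <= D n).
{ intros n Hn. unfold c. rewrite Cmod_inv by auto. destruct (HD n Hn) as [H1 H2].
  rewrite <- (Rinv_inv (D n)). apply Rinv_le_contravar; [|exact H2].
  apply Rinv_0_lt_compat, H1. }
assert (P := fun x => exp_pos x).
pose proof (abel_bound g c B N M HNM) as Ab.
assert (H1 : forall n, (N <= n)%nat -> g n = (c n * (g (S n) - g n))%C).
{ intros n Hn. unfold g. rewrite lerch_term_succ. fold (r n). unfold c.
  specialize (Hr n Hn). field. exact Hr. }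
assert (H2 : forall n, (N <= n)%nat -> Cmod ((c (S n) - c n) * g (S n)) <= B n - B (S n)).
{ intros n Hn. apply Rle_trans with (2 := proj2 (HB n Hn)).
  unfold g. rewrite Cmod_mult, Cmod_lerch_term.
  apply Rmult_le_compat_r; [left; apply P|].
  replace (c (S n) - c n)%C with (c n * c (S n) * (- (r (S n) - r n)))%C.
  2:{ unfold c. pose proof (Hr n Hn) as R1. pose proof (Hr (S n) ltac:(lia)) as R2. field. auto. }
  rewrite !Cmod_mult, Cmod_opp.
  pose proof (pos_INR n) as Pn.
  apply Rmult_le_compat; [|apply Cmod_ge_0| |].
  - apply Rmult_le_pos; apply Cmod_ge_0.
  - apply Rmult_le_compat; try apply Cmod_ge_0; apply Hc; lia.
  - unfold r. rewrite S_INR. replace (INR n + 1 + v) with (INR n + v + 1) by ring.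
    apply lerch_ratio_variation; [exact Hs|lra]. }
specialize (Ab H1 H2). destruct (HB M HNM) as [BM _].
rewrite !Cmod_mult in Ab. unfold g in Ab at 2 3. rewrite !Cmod_lerch_term in Ab.
assert (Cmod (c M) * Rpower (INR (S M) + v) (- Re s) <= D M * Rpower (INR (S M) + v) (- Re s))
  by (apply Rmult_le_compat_r; [left; apply P|apply Hc, HNM]).
assert (Cmod (c N) * Rpower (INR N + v) (- Re s) <= D N * Rpower (INR N + v) (- Re s))
  by (apply Rmult_le_compat_r; [left; apply P|apply Hc; lia]).
unfold g in *. lra.
Qed.

Lemma phase_neq_1 (lam : R) : 0 < lam < 1 -> 0 < Cmod (cexp (0, (2 * PI * lam)%R) - 1).
Proof.
intros Hl. apply Cmod_gt_0. intros E.
assert (E1 : cos (2 * PI * lam) = 1).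
{ apply (f_equal fst) in E. simpl in E. rewrite exp_0 in E. lra. }
replace (2 * PI * lam) with (2 * (PI * lam)) in E1 by ring.
rewrite cos_2a_sin in E1.
assert (0 < sin (PI * lam)).
{ pose proof PI_RGT_0. apply sin_gt_0; nra. }
nra.
Qed.

(** Far out, the ratio is within [|s| / x <= mu / 2] of the phase, hence at distance at least
    [mu / 2] from [1]. The variation telescopes through [1 / (x (x + 1)) = 1 / x - 1 / (x + 1)]. The
    two boundary terms and the variation cost [2 / mu] each. *)
Lemma lerch_sum_bound (v lam mu : R) (s : C) (N M : nat) :
  0 < v -> 0 <= Re s -> (N <= M)%nat -> 0 < mu ->
  mu = Cmod (cexp (0, (2 * PI * lam)%R) - 1) -> 2 * Cmod s <= mu * (INR N + v) ->
  Cmod (Csum (lerch_term v lam s) N M) <=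
    6 / mu * Rpower (INR N + v) (- Re s).
Proof.
intros Hv Hs HNM Hmu Emu Hsz.
pose proof (pos_INR N) as PN.
set (xN := INR N + v) in *. assert (HxN : 0 < xN) by (unfold xN; lra).
set (Q := Rpower xN (- Re s)). assert (HQ : 0 < Q) by apply exp_pos.
pose proof (Cmod_ge_0 s) as Hs0.
assert (Hx : forall n, (N <= n)%nat -> xN <= INR n + v).
{ intros n Hn. apply le_INR in Hn. unfold xN. lra. }
eapply Rle_trans.
- apply (lerch_sum_abel v lam s N M (fun _ => 2 / mu)
    (fun n => (2 / mu) ^ 2 * Cmod s * Q / (INR n + v))); auto.
  + intros n Hn. specialize (Hx n Hn). split; [apply Rdiv_lt_0_compat; lra|].
    set (x := INR n + v) in *.
    replace (/ (2 / mu)) with (mu / 2) by (field; lra).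
    unfold lerch_ratio. set (w := ln (x + 1) - ln x).
    assert (Hw : 0 <= w <= / x).
    { split; [|apply ln_diff_upper; lra].
      pose proof (ln_diff_lower x ltac:(lra)).
      assert (0 < / (x + 1)) by (apply Rinv_0_lt_compat; lra). unfold w; lra. }
    replace (cexp (0, (2 * PI * lam)%R) * cexp (- s * w) - 1)%C with
      ((cexp (0, (2 * PI * lam)%R) - 1)
        - cexp (0, (2 * PI * lam)%R) * (cexp 0 - cexp (- s * w)))%C by (rewrite cexp_0; ring).
    eapply Rle_trans; [|apply Cmod_triangle_rev]. rewrite <- Emu, Cmod_mult, Cmod_phase.
    assert (L : Cmod (cexp 0 - cexp (- s * w)) <= exp 0 * Cmod (0 - - s * w)).
    { apply cexp_lipschitz; [simpl; lra|]. destruct s; simpl in *; nra. }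
    rewrite exp_0, Rmult_1_l in L. rewrite Rmult_1_l.
    replace (0 - - s * w)%C with (s * w)%C in L by ring.
    rewrite Cmod_mult, Cmod_R, Rabs_pos_eq in L by lra.
    assert (Cmod s * w <= mu / 2).
    { apply Rle_trans with (Cmod s * / x); [apply Rmult_le_compat_l; lra|].
      apply (Rmult_le_reg_r x); [lra|]. rewrite Rmult_assoc, Rinv_l by lra. nra. }
    lra.
  + intros n Hn. pose proof (Hx n Hn) as H1. pose proof (Hx (S n) ltac:(lia)) as H2.
    rewrite S_INR in *. set (x := INR n + v) in *.
    replace (INR n + 1 + v) with (x + 1) in * by (unfold x; ring).
    assert (HA : 0 <= (2 / mu) ^ 2) by apply pow2_ge_0.
    split; [apply Rdiv_le_0_compat; [|lra]; apply Rmult_le_pos; [nra|lra]|].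
    replace ((2 / mu) ^ 2 * Cmod s * Q / x - (2 / mu) ^ 2 * Cmod s * Q / (x + 1))
      with (2 / mu * (2 / mu) * (Cmod s / (x * (x + 1))) * Q) by (field; lra).
    apply Rmult_le_compat_l.
    * apply Rmult_le_pos; [nra|]. apply Rdiv_le_0_compat; nra.
    * apply Rpower_neg_le; auto.
- fold xN. fold Q.
  assert (Rpower (INR (S M) + v) (- Re s) <= Q) by (apply Rpower_neg_le; auto; apply Hx; lia).
  assert (HA : 0 < 2 / mu) by (apply Rdiv_lt_0_compat; lra).
  assert (2 / mu * Rpower (INR (S M) + v) (- Re s) <= 2 / mu * Q)
    by (apply Rmult_le_compat_l; lra).
  assert ((2 / mu) ^ 2 * Cmod s * Q / xN <= 2 / mu * Q).
  { apply (Rmult_le_reg_r xN); [exact HxN|].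
    replace ((2 / mu) ^ 2 * Cmod s * Q / xN * xN) with
      (2 * Cmod s * (2 * Q / mu ^ 2)) by (field; lra).
    replace (2 / mu * Q * xN) with (mu * xN * (2 * Q / mu ^ 2)) by (field; lra).
    apply Rmult_le_compat_r; [|exact Hsz].
    apply Rdiv_le_0_compat; [lra|apply pow_lt, Hmu]. }
  replace (6 / mu * Q) with (2 / mu * Q + 2 / mu * Q + 2 / mu * Q) by (field; lra). lra.
Qed.

Lemma sin_half_le (x : R) : 0 <= x <= 1 -> x / 2 <= sin x.
Proof.
intros Hx.
destruct (MVT_gen (fun y => sin y - y / 2) 0 x (fun y => cos y - 1 / 2)) as [c [Hc E]].
- intros y _. auto_derive; auto. field.
- intros y _. apply continuity_pt_filterlim.
  apply (@ex_derive_continuous R_AbsRing R_NormedModule (fun y => sin y - y / 2)).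
  auto_derive; auto.
- rewrite Rmin_left, Rmax_right in Hc by lra. rewrite sin_0 in E.
  pose proof PI2_3_2 as HP.
  assert (1 / 2 <= cos c).
  { rewrite <- cos_PI3. apply cos_decr_1; try lra. }
  nra.
Qed.

(** For [lambda = 1] the distance to [1] is read off the imaginary part, [exp (- sigma w) sin (t w)]
    up to sign, with [w] between [1 / (2 x)] and [1 / x]. The condition [t <= x] keeps [t w] in
    [[0, 1]], where the sine is at least half its argument. Real parts up to [3] are allowed because
    the exponent will be shifted by one. *)
Lemma hurwitz_ratio_lower (s : C) (x : R) : 0 <= Re s <= 3 -> 1 <= x -> 0 < Im s <= x ->
  / (4 * exp 3 * x / Im s) <= Cmod (lerch_ratio 1 s x - 1).
Proof.
intros Hs Hx Ht. destruct s as [sg t]; simpl in *.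
pose proof (exp_pos 3) as E3.
pose proof (ln_diff_upper x ltac:(lra)) as L1. pose proof (ln_diff_lower x ltac:(lra)) as L2.
unfold lerch_ratio. set (w := ln (x + 1) - ln x) in *.
assert (Hix : / x <= 1) by (rewrite <- Rinv_1; apply Rinv_le_contravar; lra).
assert (Hw : / (2 * x) <= w).
{ apply Rle_trans with (2 := L2), Rinv_le_contravar; lra. }
assert (Hw0 : 0 < / (2 * x)) by (apply Rinv_0_lt_compat; lra).
assert (E1 : cexp (0, 2 * PI * 1) = 1).
{ rewrite Rmult_1_r. unfold cexp; simpl. rewrite cos_2PI, sin_2PI, exp_0.
  unfold RtoC. f_equal; ring. }
rewrite E1, Cmult_1_l.
eapply Rle_trans; [|apply abs_snd_le_Cmod].
assert (Es : snd (cexp (- (sg, t) * RtoC w) - 1)%C = - (exp (- (sg * w)) * sin (t * w))).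
{ unfold cexp; simpl.
  replace (- sg * w - - t * 0) with (- (sg * w)) by ring.
  replace (- sg * 0 + - t * w) with (- (t * w)) by ring. rewrite sin_neg. ring. }
rewrite Es, Rabs_Ropp.
assert (Htw : 0 <= t * w <= 1).
{ split; [nra|]. apply Rle_trans with (x * / x); [|right; field; lra].
  apply Rmult_le_compat; lra. }
pose proof (sin_half_le _ Htw) as Hsin.
assert (Hexp : exp (- (3)) <= exp (- (sg * w))) by (apply exp_le; nra).
rewrite (exp_Ropp 3) in Hexp.
assert (E3' : 0 < / exp 3) by (apply Rinv_0_lt_compat, E3).
rewrite Rabs_pos_eq by (apply Rmult_le_pos; [left; apply exp_pos|lra]).
apply Rle_trans with (/ exp 3 * (t * (/ (2 * x)) / 2)).
- right. field. lra.
- apply Rmult_le_compat; try lra.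
  + apply Rdiv_le_0_compat; [|lra]. nra.
  + assert (t * / (2 * x) <= t * w) by (apply Rmult_le_compat_l; lra). lra.
Qed.

(** The coefficients are bounded by [D n] of order [x / t], but the product of two consecutive ones
    cancels the [x (x + 1)] of the variation and leaves a telescoping sum; the factor [2] in the
    potential comes from [sg >= 1 / 2]. The additional [1] in the exponent keeps the boundary terms
    at size [x^(-sg) / t]. *)
Lemma hurwitz_sum_bound (v sg t : R) (N M : nat) :
  0 < v -> 1 / 2 <= sg <= 2 -> 1 <= INR N + v -> 0 < t <= INR N + v -> (N <= M)%nat ->
  Cmod (Csum (lerch_term v 1 (sg + 1, t)) N M) <=
    Rpower (INR N + v) (- sg) / t * (2 * (4 * exp 3)
      + 2 * (4 * exp 3) ^ 2 * (Cmod (sg + 1, t) / t)).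
Proof.
intros Hv Hsg HN1 Ht HNM.
set (A := 4 * exp 3). assert (HA : 0 < A) by (unfold A; pose proof (exp_pos 3); lra).
set (z := (sg + 1, t) : C).
pose proof (Cmod_ge_0 z) as Hz.
assert (Hx : forall n, (N <= n)%nat -> INR N + v <= INR n + v).
{ intros n Hn. apply le_INR in Hn. lra. }
eapply Rle_trans.
- apply (lerch_sum_abel v 1 z N M (fun n => A * (INR n + v) / t)
    (fun n => 2 * A ^ 2 * Cmod z / t ^ 2 * Rpower (INR n + v) (- sg))); auto.
  + simpl; lra.
  + intros n Hn. specialize (Hx n Hn). split.
    * apply Rdiv_lt_0_compat; nra.
    * apply (hurwitz_ratio_lower z (INR n + v)); simpl; lra.
  + intros n Hn. specialize (Hx n Hn). rewrite S_INR.
    set (x := INR n + v) in *. replace (INR n + 1 + v) with (x + 1) by (unfold x; ring).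
    assert (HK : 0 <= A ^ 2 * Cmod z / t ^ 2).
    { apply Rdiv_le_0_compat; [|apply pow_lt; lra].
      apply Rmult_le_pos; [apply pow2_ge_0|exact Hz]. }
    split; [apply Rmult_le_pos; [|left; apply exp_pos];
      replace (2 * A ^ 2 * Cmod z / t ^ 2) with (2 * (A ^ 2 * Cmod z / t ^ 2)) by (field; lra); lra|].
    change (Re z) with (sg + 1).
    replace (A * x / t * (A * (x + 1) / t) * (Cmod z / (x * (x + 1))))
      with (A ^ 2 * Cmod z / t ^ 2) by (field; lra).
    replace (2 * A ^ 2 * Cmod z / t ^ 2 * Rpower x (- sg)
      - 2 * A ^ 2 * Cmod z / t ^ 2 * Rpower (x + 1) (- sg)) with
      (A ^ 2 * Cmod z / t ^ 2 * (2 * (Rpower x (- sg) - Rpower (x + 1) (- sg))))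
      by (field; lra).
    apply Rmult_le_compat_l; [exact HK|].
    pose proof (Rpower_neg_telescope x sg ltac:(lra) ltac:(lra)) as T.
    assert (0 < Rpower (x + 1) (- (sg + 1))) by apply exp_pos. nra.
- change (Re z) with (sg + 1).
  replace (A * (INR N + v) / t * Rpower (INR N + v) (- (sg + 1)))
    with (A / t * (Rpower (INR N + v) (- (sg + 1)) * (INR N + v))) by (field; lra).
  rewrite Rpower_neg_succ by lra.
  assert (HM : A * (INR M + v) / t * Rpower (INR (S M) + v) (- (sg + 1)) <=
    A / t * Rpower (INR N + v) (- sg)).
  { pose proof (Hx M HNM) as HxM. rewrite S_INR.
    set (x := INR M + v) in *. replace (INR M + 1 + v) with (x + 1) by (unfold x; ring).
    assert (0 < A / t) by (apply Rdiv_lt_0_compat; lra).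
    replace (A * x / t * Rpower (x + 1) (- (sg + 1))) with
      (A / t * (Rpower (x + 1) (- (sg + 1)) * x)) by (field; lra).
    apply Rmult_le_compat_l; [lra|].
    apply Rle_trans with (Rpower (x + 1) (- (sg + 1)) * (x + 1)).
    - apply Rmult_le_compat_l; [left; apply exp_pos|lra].
    - rewrite Rpower_neg_succ by lra. apply Rpower_neg_le; lra. }
  set (Q := Rpower (INR N + v) (- sg)) in *.
  replace (Q / t * (2 * A + 2 * A ^ 2 * (Cmod z / t))) with
    (A / t * Q + A / t * Q + 2 * A ^ 2 * Cmod z / t ^ 2 * Q) by (field; lra).
  lra.
Qed.

(** * Approximation on the critical line *)

Definition path_derive (f : R -> C) (x : R) (l : C) : Prop :=
  is_derive (fun u => fst (f u)) x (fst l) /\ is_derive (fun u => snd (f u)) x (snd l).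

Lemma path_mean_value (f df : R -> C) (p q B : R) : p <= q ->
  (forall x, p <= x <= q -> path_derive f x (df x)) ->
  (forall x, p <= x <= q -> Cmod (df x) <= B) ->
  Cmod (f q - f p) <= (q - p) * B.
Proof.
intros Hpq Hf HB.
apply (C_mean_value_ineq (fun u => fst (f u)) (fun u => snd (f u))
  (fun u => fst (df u)) (fun u => snd (df u)) p q B Hpq).
- intros x Hx. apply (Hf x Hx).
- intros x Hx. apply (Hf x Hx).
- intros x Hx. rewrite <- surjective_pairing. apply HB, Hx.
Qed.

Lemma path_derive_Csum (f : nat -> R -> C) (l : nat -> C) (x : R) (N M : nat) :
  (N <= M)%nat -> (forall n, path_derive (f n) x (l n)) ->
  path_derive (fun u => Csum (fun n => f n u) N M) x (Csum l N M).
Proof.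
intros HNM H. induction HNM as [|M HNM IH].
- rewrite Csum_n_n. destruct (H N) as [H1 H2]. split;
  (eapply is_derive_ext; [|eassumption]); intros u; rewrite Csum_n_n; reflexivity.
- rewrite Csum_n_Sm by lia. destruct IH as [I1 I2]. destruct (H (S M)) as [H1 H2]. split.
  + eapply is_derive_ext; [|exact (is_derive_plus _ _ _ _ _ I1 H1)].
    intros u. rewrite Csum_n_Sm by lia. reflexivity.
  + eapply is_derive_ext; [|exact (is_derive_plus _ _ _ _ _ I2 H2)].
    intros u. rewrite Csum_n_Sm by lia. reflexivity.
Qed.

Lemma cpow_pos_pred (x : R) (w : C) : 0 < x -> cpow_pos x (w - 1) = (cpow_pos x w * RtoC (/ x))%C.
Proof.
intros Hx. unfold cpow_pos.
replace ((w - 1) * ln x)%C with (w * ln x + RtoC (- ln x))%C by (rewrite RtoC_opp; ring).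
rewrite cexp_plus. f_equal. unfold cexp, RtoC; simpl.
rewrite cos_0, sin_0, exp_Ropp, exp_ln by exact Hx. f_equal; ring.
Qed.

Lemma cpow_pos_pair (x w1 w2 : R) :
  cpow_pos x (w1, w2) = (exp (w1 * ln x) * cos (w2 * ln x), exp (w1 * ln x) * sin (w2 * ln x)).
Proof.
unfold cpow_pos, cexp; simpl.
replace (w1 * ln x - w2 * 0) with (w1 * ln x) by ring.
replace (w1 * 0 + w2 * ln x) with (w2 * ln x) by ring. reflexivity.
Qed.

Lemma path_derive_cpow_pos (x u : R) (w : C) : 0 < x + u ->
  path_derive (fun u => cpow_pos (x + u) w) u (w * cpow_pos (x + u) (w - 1)).
Proof.
intros Hx. rewrite cpow_pos_pred by exact Hx. destruct w as [w1 w2].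
split; (eapply is_derive_ext; [intros v; rewrite cpow_pos_pair; reflexivity|]);
rewrite cpow_pos_pair; simpl; auto_derive; auto; field; lra.
Qed.

Lemma path_derive_affine (f : R -> C) (x : R) (l c d : C) : path_derive f x l ->
  path_derive (fun u => c + d * f u)%C x (d * l).
Proof.
intros [H1 H2]. destruct c as [c1 c2], d as [d1 d2], l as [l1 l2].
unfold path_derive; simpl in *. split.
- replace (d1 * l1 - d2 * l2) with (0 + (d1 * l1 - d2 * l2)) by ring.
  apply (is_derive_plus (fun _ => c1)); [apply @is_derive_const|].
  apply (is_derive_minus (fun u => d1 * fst (f u)) (fun u => d2 * snd (f u)));
  apply is_derive_scal; assumption.
- replace (d1 * l2 + d2 * l1) with (0 + (d1 * l2 + d2 * l1)) by ring.
  apply (is_derive_plus (fun _ => c2)); [apply @is_derive_const|].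
  apply (is_derive_plus (fun u => d1 * snd (f u)) (fun u => d2 * fst (f u)));
  apply is_derive_scal; assumption.
Qed.

Lemma lerch_term_1 (a : R) (s : C) (n : nat) :
  lerch_term a 1 s n = cpow_pos (INR n + a) (- s).
Proof.
unfold lerch_term.
replace (cexp (0, 2 * PI * INR n * 1)) with (RtoC 1); [ring|].
unfold cexp; simpl. replace (2 * PI * INR n * 1) with (0 + 2 * INR n * PI) by ring.
rewrite cos_period, sin_period, cos_0, sin_0, exp_0. unfold RtoC. f_equal; ring.
Qed.

Lemma Csum_ext (f g : nat -> C) (N M : nat) : (forall n, f n = g n) -> Csum f N M = Csum g N M.
Proof. intros H. apply sum_n_m_ext, H. Qed.

Lemma Csum_scal (c : C) (f : nat -> C) (N M : nat) :
  Csum (fun n => c * f n)%C N M = (c * Csum f N M)%C.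
Proof. exact (@sum_n_m_mult_l C_Ring c f N M). Qed.

Lemma Csum_telescope (f : nat -> C) (N M : nat) : (N <= M)%nat ->
  Csum (fun n => f (S n) - f n)%C N M = (f (S M) - f N)%C.
Proof.
intros H. induction H as [|M H IH]; [apply Csum_n_n|].
rewrite Csum_n_Sm, IH by lia. ring.
Qed.

(** A primitive of [x^(-s)] in [x]; for [Re s > 1] its opposite is the integral of [y^(-s)] over
    [y >= x]. *)
Definition hurwitz_tail (x : R) (s : C) : C := (cpow_pos x (1 - s) / (1 - s))%C.

(* Both [P] and its derivative [Q] vanish at [0], and [Q'] is [s] times an oscillating sum
   with exponent [s + 1], so two applications of the mean value inequality suffice. *)
Lemma hurwitz_sum_integral (a sg t : R) (N M : nat) :
  0 < a -> 1 / 2 <= sg <= 2 -> 1 <= INR N + a -> 0 < t <= INR N + a -> (N <= M)%nat ->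
  Cmod (Csum (lerch_term a 1 (sg, t)) N M
     + (hurwitz_tail (INR N + a) (sg, t) - hurwitz_tail (INR (S M) + a) (sg, t))) <=
  Cmod (sg, t) * (Rpower (INR N + a) (- sg) / t * (2 * (4 * exp 3)
      + 2 * (4 * exp 3) ^ 2 * (Cmod (sg + 1, t) / t))).
Proof.
intros Ha Hsg HN1 Ht HNM.
set (s := (sg, t) : C). set (x := fun n => INR n + a).
assert (Hx : forall n, 0 < x n) by (intros n; unfold x; pose proof (pos_INR n); lra).
assert (Hs1 : (1 - s)%C <> 0).
{ intros E. apply (f_equal snd) in E. simpl in E. lra. }
set (B := Cmod s * (Rpower (INR N + a) (- sg) / t * (2 * (4 * exp 3)
      + 2 * (4 * exp 3) ^ 2 * (Cmod (sg + 1, t) / t)))).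
assert (HB : 0 <= B).
{ unfold B. pose proof (exp_pos 3) as E3. pose proof (Cmod_ge_0 (sg + 1, t)).
  apply Rmult_le_pos; [apply Cmod_ge_0|]. apply Rmult_le_pos.
  - apply Rdiv_le_0_compat; [left; apply exp_pos|lra].
  - assert (0 <= Cmod (sg + 1, t) / t) by (apply Rdiv_le_0_compat; lra).
    assert (0 <= (4 * exp 3) ^ 2) by apply pow2_ge_0. nra. }
set (q := fun n (u : R) => (cpow_pos (x n) (- s) + (-(1)) * cpow_pos (x n + u) (- s))%C).
set (Q := fun u => Csum (fun n => q n u) N M).
(* The integral of [q n] from [0] to [u]. At [u = 1] it is the term at [x n] minus the integral of
   [y^(-s)] over [[x n, x n + 1]]. *)
set (p := fun n (u : R) => (RtoC u * cpow_pos (x n) (- s)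
   + (- (cpow_pos (x n + u) (1 - s) - cpow_pos (x n) (1 - s)) / (1 - s)))%C).
set (P := fun u => Csum (fun n => p n u) N M).
assert (HQ' : forall u, 0 <= u <= 1 ->
  path_derive Q u (s * Csum (lerch_term (a + u) 1 (sg + 1, t)) N M)).
{ intros u Hu. rewrite <- Csum_scal. apply path_derive_Csum; [exact HNM|].
  intros n. rewrite lerch_term_1. unfold q.
  replace (s * cpow_pos (INR n + (a + u)) (- ((sg + 1)%R, t)))%C with
    (- (1) * (- s * cpow_pos (x n + u) (- s - 1)))%C.
  - apply path_derive_affine, path_derive_cpow_pos. specialize (Hx n). lra.
  - unfold x. replace (INR n + (a + u)) with (INR n + a + u) by ring.
    replace (- ((sg + 1)%R, t))%C with (- s - 1)%C; [ring|].
    unfold s. apply injective_projections; simpl; ring. }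
assert (HP' : forall u, 0 <= u <= 1 -> path_derive P u (Q u)).
{ intros u Hu. apply path_derive_Csum; [exact HNM|].
  intros n. unfold q.
  pose proof (path_derive_cpow_pos (x n) u (1 - s) ltac:(specialize (Hx n); lra)) as D.
  apply (path_derive_affine _ _ _ (cpow_pos (x n) (1 - s) / (1 - s)) (- / (1 - s))) in D.
  destruct D as [D1 D2].
  assert (E : (- / (1 - s) * ((1 - s) * cpow_pos (x n + u) (1 - s - 1)) =
    - (1) * cpow_pos (x n + u) (- s))%C).
  { replace (1 - s - 1)%C with (- s)%C by ring. field. exact Hs1. }
  rewrite E in D1, D2.
  assert (L : path_derive (fun u => RtoC u * cpow_pos (x n) (- s))%C u (cpow_pos (x n) (- s))).
  { destruct (cpow_pos (x n) (- s)) as [k1 k2]. split; simpl; auto_derive; auto; ring. }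
  destruct L as [L1 L2]. split.
  - eapply is_derive_ext; [|exact (is_derive_plus _ _ _ _ _ L1 D1)].
    intros v. cbv beta. unfold p. change plus with Rplus.
    match goal with |- ?A = _ => transitivity A; [reflexivity|] end.
    assert (E2 : (- (cpow_pos (x n + v) (1 - s) - cpow_pos (x n) (1 - s)) / (1 - s) =
       cpow_pos (x n) (1 - s) / (1 - s) + - / (1 - s) * cpow_pos (x n + v) (1 - s))%C)
      by (field; exact Hs1).
    rewrite E2. reflexivity.
  - eapply is_derive_ext; [|exact (is_derive_plus _ _ _ _ _ L2 D2)].
    intros v. cbv beta. unfold p. change plus with Rplus.
    assert (E2 : (- (cpow_pos (x n + v) (1 - s) - cpow_pos (x n) (1 - s)) / (1 - s) =
       cpow_pos (x n) (1 - s) / (1 - s) + - / (1 - s) * cpow_pos (x n + v) (1 - s))%C)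
      by (field; exact Hs1).
    rewrite E2. reflexivity. }
assert (Hq0 : Q 0 = 0).
{ unfold Q. rewrite (Csum_ext _ (fun n => (0 - 0)%C)).
  - rewrite (Csum_telescope (fun _ => RtoC 0)) by exact HNM. ring.
  - intros n. unfold q. rewrite Rplus_0_r. ring. }
assert (Hp0 : P 0 = 0).
{ unfold P. rewrite (Csum_ext _ (fun n => (0 - 0)%C)).
  - rewrite (Csum_telescope (fun _ => RtoC 0)) by exact HNM. ring.
  - intros n. unfold p. rewrite Rplus_0_r. field. exact Hs1. }
assert (HQ : forall u, 0 <= u <= 1 -> Cmod (Q u) <= B).
{ intros u Hu. replace (Q u) with (Q u - Q 0)%C by (rewrite Hq0; ring).
  apply Rle_trans with ((u - 0) * B); [|nra].
  apply (path_mean_value Q (fun u => s * Csum (lerch_term (a + u) 1 ((sg + 1)%R, t)) N M)%C);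
    [lra|intros; apply HQ'; lra|].
  intros y Hy. rewrite Cmod_mult. unfold B. apply Rmult_le_compat_l; [apply Cmod_ge_0|].
  eapply Rle_trans; [apply hurwitz_sum_bound; auto; lra|].
  apply Rmult_le_compat_r.
  - pose proof (exp_pos 3) as E3. pose proof (Cmod_ge_0 (sg + 1, t)).
    assert (0 <= Cmod (sg + 1, t) / t) by (apply Rdiv_le_0_compat; lra).
    assert (0 <= (4 * exp 3) ^ 2) by apply pow2_ge_0. nra.
  - apply Rmult_le_compat_r; [left; apply Rinv_0_lt_compat; lra|].
    apply Rpower_neg_le; lra. }
assert (HP : Cmod (P 1) <= B).
{ replace (P 1) with (P 1 - P 0)%C by (rewrite Hp0; ring).
  apply Rle_trans with ((1 - 0) * B); [|lra].
  apply (path_mean_value P Q); [lra|exact HP'|exact HQ]. }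
replace (Csum (lerch_term a 1 s) N M
   + (hurwitz_tail (INR N + a) s - hurwitz_tail (INR (S M) + a) s))%C with (P 1); [exact HP|].
set (G := fun n => hurwitz_tail (x n) s).
change (P 1 = (Csum (lerch_term a 1 s) N M + (G N - G (S M)))%C).
replace (G N - G (S M))%C with (- (1) * (G (S M) - G N))%C by ring.
rewrite <- Csum_telescope, <- Csum_scal by exact HNM.
unfold P.
clear - Hs1 HNM. induction HNM as [|M HNM IH].
- rewrite !Csum_n_n. unfold p, G, hurwitz_tail, x. rewrite lerch_term_1, S_INR.
  replace (INR N + 1 + a) with (INR N + a + 1) by ring. field. exact Hs1.
- rewrite !Csum_n_Sm by lia. rewrite IH. unfold p, G, hurwitz_tail, x.
  rewrite lerch_term_1, (S_INR (S M)).
  replace (INR (S M) + 1 + a) with (INR (S M) + a + 1) by ring. field. exact Hs1.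
Qed.

Lemma Rpower_neg_to_0 (al a eps : R) : 0 < al -> 0 < a -> 0 < eps ->
  exists n0 : nat, forall n : nat, (n0 <= n)%nat -> Rpower (INR (S n) + al) (- a) <= eps.
Proof.
intros Hal Ha Heps.
set (X := exp (- ln eps / a)).
exists (Z.to_nat (up X)). intros n Hn.
assert (HX : X <= INR (S n) + al).
{ destruct (archimed X) as [H _].
  assert (0 <= up X)%Z.
  { apply le_IZR. pose proof (exp_pos (- ln eps / a)). unfold X in *. lra. }
  apply le_INR in Hn. rewrite INR_IZR_INZ, Z2Nat.id in Hn by assumption.
  rewrite S_INR. lra. }
apply ln_le in HX; [|apply exp_pos]. unfold X in HX. rewrite ln_exp in HX.
rewrite <- (exp_ln eps) by exact Heps. apply exp_le.
apply (Rmult_le_compat_l a) in HX; [|lra].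
replace (a * (- ln eps / a)) with (- ln eps) in HX by (field; lra). lra.
Qed.

(** The factor [k] will be [1] for [lambda = 1] and [0] otherwise: only without oscillation do the
    partial sums on the critical line grow, and then like the primitive subtracted here. For
    [Re s > 1] this primitive tends to [0], so the limit is the same for both values. *)
Definition lerch_approx (al lam : R) (k : C) (N : nat) (s : C) : C :=
  (Csum (lerch_term al lam s) 0 N + k * hurwitz_tail (INR (S N) + al) s * (-(1)))%C.

Lemma holo_lerch_approx (al lam : R) (k : C) (N : nat) (s : C) : s <> 1 ->
  holo (lerch_approx al lam k N) s.
Proof.
intros Hs. unfold lerch_approx. apply holo_plus.
- apply (holo_Csum (fun n s => lerch_term al lam s n)); [lia|]. intros n. unfold lerch_term.
  apply holo_scal. unfold cpow_pos.
  apply holo_ext with (fun w => cexp (RtoC (- ln (INR n + al)) * w)).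
  { intros w. f_equal. rewrite RtoC_opp. ring. }
  apply (holo_comp cexp); [apply holo_scal, holo_id|apply holo_cexp].
- apply holo_mult; [|apply holo_const]. apply holo_scal. unfold hurwitz_tail, cpow_pos.
  assert (H1 : holo (fun w => 1 - w)%C s).
  { apply holo_ext with (fun w => 1 + (-(1)) * w)%C; [intros; ring|].
    apply holo_plus; [apply holo_const|apply holo_scal, holo_id]. }
  apply holo_mult.
  + apply (holo_comp cexp (fun w => (1 - w) * ln (INR (S N) + al))%C); [|apply holo_cexp].
    apply holo_mult; [exact H1|apply holo_const].
  + apply (holo_comp Cinv (fun w => 1 - w)%C); [exact H1|]. apply holo_inv.
    intros E. apply Hs. rewrite <- (Cplus_0_r s), <- E. ring.
Qed.

Lemma lerch_approx_limit (al lam : R) (k : C) (F : C -> C) (s : C) :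
  0 < al -> Cmod k <= 1 -> 1 < Re s ->
  @is_series C_AbsRing C_NormedModule (lerch_term al lam s) (F s) ->
  forall eps, 0 < eps -> exists n0, forall n, (n0 <= n)%nat ->
    Cmod (F s - lerch_approx al lam k n s) <= eps.
Proof.
intros Hal Hk Hs HF eps Heps.
assert (He : 0 < eps / 4) by lra.
destruct (proj1 (filterlim_locally _ _) HF (mkposreal _ He)) as [n1 Hn1].
assert (Hd : Re s - 1 <= Cmod (1 - s)).
{ eapply Rle_trans; [|apply abs_fst_le_Cmod]. destruct s; simpl in *.
  rewrite Rabs_left by lra. lra. }
destruct (Rpower_neg_to_0 al (Re s - 1) (eps / 2 * (Re s - 1))) as [n2 Hn2]; try lra.
{ apply Rmult_lt_0_compat; lra. }
exists (Nat.max n1 n2). intros n Hn.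
specialize (Hn1 n ltac:(lia)). specialize (Hn2 n ltac:(lia)).
destruct Hn1 as [B1 B2].
change (Rabs (fst (Csum (lerch_term al lam s) 0 n) - fst (F s)) < eps / 4) in B1.
change (Rabs (snd (Csum (lerch_term al lam s) 0 n) - snd (F s)) < eps / 4) in B2.
unfold lerch_approx.
set (A := Csum (lerch_term al lam s) 0 n) in *.
set (T := hurwitz_tail (INR (S n) + al) s).
replace (F s - (A + k * T * - (1)))%C with (k * T - (A - F s))%C by ring.
eapply Rle_trans; [apply Cmod_triangle_minus|].
assert (B3 : Cmod (A - F s) <= eps / 2).
{ eapply Rle_trans; [apply Cmod_le_abs|].
  change (Rabs (fst A - fst (F s)) + Rabs (snd A - snd (F s)) <= eps / 2). lra. }
assert (B4 : Cmod (k * T) <= eps / 2).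
{ rewrite Cmod_mult. unfold T, hurwitz_tail.
  rewrite Cmod_div by (apply Cmod_gt_0; lra).
  rewrite Cmod_cpow_pos. replace (Re (1 - s)) with (- (Re s - 1)) by (destruct s; simpl; ring).
  assert (H0 : 0 <= Rpower (INR (S n) + al) (- (Re s - 1)) / Cmod (1 - s))
    by (apply Rdiv_le_0_compat; [left; apply exp_pos|lra]).
  apply Rle_trans with (Rpower (INR (S n) + al) (- (Re s - 1)) / Cmod (1 - s)).
  { pose proof (Cmod_ge_0 k). nra. }
  apply (Rmult_le_reg_r (Cmod (1 - s))); [lra|].
  unfold Rdiv at 1. rewrite Rmult_assoc, Rinv_l by (apply Rgt_not_eq; lra).
  rewrite Rmult_1_r. apply Rle_trans with (1 := Hn2). apply Rmult_le_compat_l; lra. }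
lra.
Qed.

Lemma Cmod_le_re_im (x y : R) : 0 <= x -> 0 <= y -> Cmod (x, y) <= x + y.
Proof.
intros Hx Hy. eapply Rle_trans; [apply Cmod_le_abs|]. simpl.
rewrite !Rabs_pos_eq by assumption. lra.
Qed.

(** The rectangle reaches [Re s = 11 / 10], inside the half-plane of convergence; its half-height
    [8 / 10] exceeds its width [6 / 10], as the Gaussian argument requires; and for [t >= 1] it
    stays in [Im s >= 2 / 10], away from the pole. *)
Lemma lerch_approx_cauchy (al lam : R) : 0 < al <= 1 -> 0 < lam <= 1 ->
  exists (k : C) (K Q : R), Cmod k <= 1 /\ 0 <= K /\ 1 <= Q /\
    forall t n m, 1 <= t -> Q * t <= INR n -> (n <= m)%nat ->
    forall x y, 1 / 2 <= x <= 1 / 2 + 6 / 10 -> t - 8 / 10 <= y <= t + 8 / 10 ->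
    Cmod (lerch_approx al lam k m (x, y) - lerch_approx al lam k n (x, y)) <=
      K * Rpower (INR (S n) + al) (- (1 / 2)).
Proof.
intros Hal Hlam.
assert (Hmono : forall n x, 1 / 2 <= x ->
  Rpower (INR (S n) + al) (- x) <= Rpower (INR (S n) + al) (- (1 / 2))).
{ intros n x Hx. unfold Rpower. apply exp_le. rewrite S_INR.
  assert (0 <= ln (INR n + 1 + al)).
  { rewrite <- ln_1. apply ln_le; [lra|]. pose proof (pos_INR n). lra. }
  nra. }
assert (Hpos : forall n x, 0 < Rpower (INR (S n) + al) x) by (intros; apply exp_pos).
destruct (Req_dec lam 1) as [->|Hl1].
- set (A := 4 * exp 3). assert (HA : 0 < A) by (unfold A; pose proof (exp_pos 3); lra).
  (* From [x <= 11 / 10] and [y >= 2 / 10] come [|s| <= 13 / 2 y] and [|s + 1| <= 23 / 2 y]; [Q = 2]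
     gives [y <= t + 8 / 10 <= 2 t <= n]. *)
  exists 1, (13 / 2 * (2 * A + 2 * A ^ 2 * (23 / 2))), 2.
  repeat split; try (rewrite Cmod_1; lra); try lra; try nra.
  intros t n m Ht Hn Hnm x y Hx Hy.
  destruct (Nat.eq_dec n m) as [->|Hneq].
  { replace (lerch_approx al 1 1 m (x, y) - lerch_approx al 1 1 m (x, y))%C with (RtoC 0) by ring.
    rewrite Cmod_0. apply Rmult_le_pos; [nra|left; apply Hpos]. }
  replace (lerch_approx al 1 1 m (x, y) - lerch_approx al 1 1 n (x, y))%C with
    (Csum (lerch_term al 1 (x, y)) (S n) m
     + (hurwitz_tail (INR (S n) + al) (x, y) - hurwitz_tail (INR (S m) + al) (x, y)))%C.
  2:{ unfold lerch_approx. rewrite (Csum_Chasles _ 0 n m) by lia. ring. }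
  pose proof (S_INR n) as ESn.
  eapply Rle_trans; [apply hurwitz_sum_integral; try lra; lia|]. fold A.
  assert (C1 : Cmod (x, y) <= 13 / 2 * y)
    by (eapply Rle_trans; [apply Cmod_le_re_im; lra|lra]).
  assert (C2 : Cmod (x + 1, y) / y <= 23 / 2).
  { apply (Rmult_le_reg_r y); [lra|]. unfold Rdiv at 1. rewrite Rmult_assoc, Rinv_l by lra.
    eapply Rle_trans; [rewrite Rmult_1_r; apply Cmod_le_re_im; lra|lra]. }
  assert (C3 : 0 <= Cmod (x + 1, y) / y) by (apply Rdiv_le_0_compat; [apply Cmod_ge_0|lra]).
  set (D := Cmod (x + 1, y) / y) in *.
  assert (HA2 : 0 <= A ^ 2) by apply pow2_ge_0.
  specialize (Hmono n x ltac:(lra)). specialize (Hpos n (- x)).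
  set (R1 := Rpower (INR (S n) + al) (- x)) in *.
  set (R2 := Rpower (INR (S n) + al) (- (1 / 2))) in *.
  apply Rle_trans with (13 / 2 * y * (R2 / y * (2 * A + 2 * A ^ 2 * (23 / 2)))).
  + assert (H1 : 2 * A + 2 * A ^ 2 * D <= 2 * A + 2 * A ^ 2 * (23 / 2)) by nra.
    assert (H2 : R1 / y <= R2 / y)
      by (apply Rmult_le_compat_r; [left; apply Rinv_0_lt_compat; lra|lra]).
    assert (H3 : 0 <= R1 / y) by (apply Rdiv_le_0_compat; lra).
    apply Rmult_le_compat; auto; [apply Cmod_ge_0| |].
    * apply Rmult_le_pos; [exact H3|nra].
    * apply Rmult_le_compat; auto. nra.
  + right. field. lra.
- set (mu := Cmod (cexp (0, (2 * PI * lam)%R) - 1)).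
  assert (Hmu : 0 < mu) by (apply phase_neq_1; lra).
  (* On the rectangle [|s| <= 3 t], so [n >= 6 t / mu] ensures [2 |s| <= mu x], the separation of
     the ratios from [1]. *)
  exists 0, (6 / mu), (Rmax 1 (6 / mu)).
  assert (H6 : 0 < 6 / mu) by (apply Rdiv_lt_0_compat; lra).
  repeat split; try (rewrite Cmod_0; lra); try lra; [apply Rmax_l|].
  intros t n m Ht Hn Hnm x y Hx Hy.
  destruct (Nat.eq_dec n m) as [->|Hneq].
  { replace (lerch_approx al lam 0 m (x, y) - lerch_approx al lam 0 m (x, y))%C
      with (RtoC 0) by ring.
    rewrite Cmod_0. apply Rmult_le_pos; [lra|left; apply Hpos]. }
  replace (lerch_approx al lam 0 m (x, y) - lerch_approx al lam 0 n (x, y))%C with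
    (Csum (lerch_term al lam (x, y)) (S n) m).
  2:{ unfold lerch_approx. rewrite (Csum_Chasles _ 0 n m) by lia. ring. }
  pose proof (S_INR n) as ESn.
  eapply Rle_trans; [apply (lerch_sum_bound al lam mu); auto; try lia; try (simpl; lra)|].
  + assert (Cmod (x, y) <= 3 * t)
      by (eapply Rle_trans; [apply Cmod_le_re_im; lra|lra]).
    assert (6 / mu * t <= INR n).
    { apply Rle_trans with (2 := Hn). apply Rmult_le_compat_r; [lra|apply Rmax_r]. }
    assert (E : 6 * t = mu * (6 / mu * t)) by (field; lra).
    assert (mu * (6 / mu * t) <= mu * INR n) by (apply Rmult_le_compat_l; lra).
    assert (0 <= mu * (1 + al)) by nra. nra.
  + apply Rmult_le_compat_l; [lra|]. apply Hmono. simpl; lra.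
Qed.

Theorem lerch_approximation (al lam : R) (F : C -> C) :
  0 < al <= 1 -> 0 < lam <= 1 -> is_lerch_zeta al lam F ->
  exists K Q : R, 0 <= K /\ 1 <= Q /\
    forall t n, 1 <= t -> Q * t <= INR n ->
    Cmod (F (1 / 2, t) - Csum (lerch_term al lam (1 / 2, t)) 0 n) <= K * (1 + sqrt (INR n) / t).
Proof.
intros Hal Hlam [HF1 HF2].
destruct (lerch_approx_cauchy al lam Hal Hlam) as [k [K [Q [Hk [HK [HQ Hc]]]]]].
exists (K + 2), Q. split; [lra|]. split; [exact HQ|].
intros t n Ht Hn.
assert (Hne : forall x y, 0 < y -> (x, y) <> RtoC 1).
{ intros x y Hy E. apply (f_equal snd) in E. simpl in E. lra. }
assert (Hlim : Cmod (F (1 / 2, t) - lerch_approx al lam k n (1 / 2, t)) <=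
  K * Rpower (INR (S n) + al) (- (1 / 2))).
{ apply (limit_identification F (lerch_approx al lam k)
    (fun n => K * Rpower (INR (S n) + al) (- (1 / 2))) n (1 / 2) t (6 / 10) (8 / 10)); auto.
  - lra.
  - intros x y Hx Hy. apply holo_of_ex_derive, HF1, Hne. lra.
  - intros j x y Hx Hy. apply holo_lerch_approx, Hne. lra.
  - intros i m Him x y Hx Hy. apply (Hc t); auto; try lia.
    apply Rle_trans with (1 := Hn). apply le_INR. lia.
  - intros eps Heps.
    destruct (Rpower_neg_to_0 al (1 / 2) (eps / (K + 1))) as [n0 Hn0]; try lra.
    { apply Rdiv_lt_0_compat; lra. }
    exists n0. intros i Hi. specialize (Hn0 i Hi).
    apply Rle_trans with (K * (eps / (K + 1))); [apply Rmult_le_compat_l; assumption|].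
    apply (Rmult_le_reg_r (K + 1)); [lra|]. field_simplify; [nra|lra].
  - intros y eps Heps. apply (lerch_approx_limit al lam k F); auto; try (simpl; lra).
    apply HF2. simpl; lra. }
assert (H1 : Rpower (INR (S n) + al) (- (1 / 2)) <= 1).
{ apply Rle_trans with (exp 0); [|right; apply exp_0]. apply exp_le. rewrite S_INR.
  assert (0 <= ln (INR n + 1 + al)).
  { rewrite <- ln_1. apply ln_le; [lra|]. pose proof (pos_INR n). lra. }
  nra. }
assert (Hn1 : 1 <= INR n) by nra.
assert (Hs : 1 <= sqrt (INR n)) by (rewrite <- sqrt_1; apply sqrt_le_1_alt, Hn1).
(* The primitive is the only source of [sqrt (INR n) / t] in the error; the approximation including
   it is within a constant of [F]. *)
assert (HT : Cmod (k * hurwitz_tail (INR (S n) + al) (1 / 2, t)) <= 2 * (sqrt (INR n) / t)).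
{ rewrite Cmod_mult. unfold hurwitz_tail.
  assert (D : t <= Cmod (1 - (1 / 2, t))).
  { eapply Rle_trans; [|apply abs_snd_le_Cmod]. simpl. rewrite Rabs_left; lra. }
  rewrite Cmod_div by (apply Cmod_gt_0; lra). rewrite Cmod_cpow_pos.
  replace (Re (1 - ((1 / 2)%R, t))) with (/ 2) by (simpl; lra).
  rewrite Rpower_sqrt by (rewrite S_INR; lra).
  assert (S2 : sqrt (INR (S n) + al) <= 2 * sqrt (INR n)).
  { replace 2 with (sqrt (2 * 2)) by (apply sqrt_square; lra).
    rewrite <- sqrt_mult by lra. apply sqrt_le_1_alt. rewrite S_INR. lra. }
  assert (I : / Cmod (1 - ((1 / 2)%R, t)) <= / t) by (apply Rinv_le_contravar; lra).
  assert (I0 : 0 < / Cmod (1 - ((1 / 2)%R, t))) by (apply Rinv_0_lt_compat; lra).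
  pose proof (sqrt_pos (INR (S n) + al)) as P0. pose proof (Cmod_ge_0 k).
  apply Rle_trans with (1 * (2 * sqrt (INR n) * / t)); [|right; field; lra].
  apply Rmult_le_compat; auto.
  - apply Rmult_le_pos; lra.
  - apply Rmult_le_compat; lra. }
replace (F ((1 / 2)%R, t) - Csum (lerch_term al lam ((1 / 2)%R, t)) 0 n)%C with
  ((F ((1 / 2)%R, t) - lerch_approx al lam k n ((1 / 2)%R, t))
    - k * hurwitz_tail (INR (S n) + al) ((1 / 2)%R, t))%C by (unfold lerch_approx; ring).
eapply Rle_trans; [apply Cmod_triangle_minus|].
assert (0 <= sqrt (INR n) / t) by (apply Rdiv_le_0_compat; lra).
assert (K * Rpower (INR (S n) + al) (- (1 / 2)) <= K * 1) by (apply Rmult_le_compat_l; lra).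
nra.
Qed.

(** * Mean square of the partial sums *)

Lemma sum_f_R0_le_count (f : nat -> R) (N : nat) (B : R) :
  (forall n, (n <= N)%nat -> f n <= B) -> sum_f_R0 f N <= INR (S N) * B.
Proof.
intros H. rewrite Rmult_comm, <- sum_cte. apply sum_Rle. exact H.
Qed.

Lemma sum_f_R0_mul (f g : nat -> R) (N M : nat) :
  sum_f_R0 f N * sum_f_R0 g M = sum_f_R0 (fun m => sum_f_R0 (fun n => f m * g n) M) N.
Proof.
rewrite Rmult_comm, scal_sum. apply sum_eq. intros m _. rewrite scal_sum.
apply sum_eq. intros n _. ring.
Qed.

Lemma is_derive_sum_f_R0 (f df : nat -> R -> R) (N : nat) (x : R) :
  (forall n, is_derive (f n) x (df n x)) ->
  is_derive (fun y => sum_f_R0 (fun n => f n y) N) x (sum_f_R0 (fun n => df n x) N).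
Proof.
intros H. induction N as [|N IH]; simpl; [apply H|].
exact (is_derive_plus _ _ _ _ _ IH (H (S N))).
Qed.

Lemma Rabs_sum_f_R0_minus (f g w : nat -> R) (N : nat) :
  (forall n, (n <= N)%nat -> Rabs (f n - g n) <= w n) ->
  Rabs (sum_f_R0 f N - sum_f_R0 g N) <= sum_f_R0 w N.
Proof.
intros H. rewrite <- minus_sum. eapply Rle_trans; [apply Rabs_triang_gen|]. apply sum_Rle, H.
Qed.

(* Averaging the end points of the interval over length [D] turns the integral of
   [f = Phi' >= 0] into second differences of [Psi], where [Psi' = Phi]. *)
Lemma end_point_averaging (f Phi Psi : R -> R) (p q D : R) : 0 < D ->
  (forall x, is_derive Phi x (f x)) -> (forall x, is_derive Psi x (Phi x)) ->
  (forall x, 0 <= f x) ->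
  Psi q - Psi (q - D) - Psi (p + D) + Psi p <= D * (Phi q - Phi p)
    <= Psi (q + D) - Psi q - Psi p + Psi (p - D).
Proof.
intros HD HPhi HPsi Hf.
assert (Mono : forall x y, x <= y -> Phi x <= Phi y).
{ intros x y Hxy. destruct (MVT_gen Phi x y f) as [c [_ E]].
  - intros; apply HPhi.
  - intros z _. apply continuity_pt_filterlim, (ex_derive_continuous Phi). eexists; apply HPhi.
  - specialize (Hf c). nra. }
assert (Avg : forall x, D * Phi x <= Psi (x + D) - Psi x <= D * Phi (x + D)).
{ intros x. destruct (MVT_gen Psi x (x + D) Phi) as [c [Hc E]].
  - intros; apply HPsi.
  - intros z _. apply continuity_pt_filterlim, (ex_derive_continuous Psi). eexists; apply HPsi.
  - rewrite Rmin_left, Rmax_right in Hc by lra.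
    pose proof (Mono x c ltac:(lra)). pose proof (Mono c (x + D) ltac:(lra)). nra. }
pose proof (Avg q). pose proof (Avg p). pose proof (Avg (q - D)) as A1.
pose proof (Avg (p - D)) as A2.
replace (q - D + D) with q in A1 by ring. replace (p - D + D) with p in A2 by ring. lra.
Qed.

Section Trigonometric_polynomial.

Variables (b x th : nat -> R) (N : nat).
Hypothesis Hinj : forall m n, m <> n -> ln (x m) <> ln (x n).

Let u (m n : nat) : R := ln (x n) - ln (x m).
Let ph (m n : nat) (t : R) : R := th m - th n + t * u m n.

Let u_neq_0 (m n : nat) : m <> n -> u m n <> 0.
Proof. intros H E. apply (Hinj m n H). unfold u in E. lra. Qed.

(** The squared modulus of the sum of [b n exp (i (th n - t log (x n)))]. *)
Definition trig_square (t : R) : R :=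
  sum_f_R0 (fun n => b n * cos (th n - t * ln (x n))) N ^ 2 +
  sum_f_R0 (fun n => b n * sin (th n - t * ln (x n))) N ^ 2.

Let psi0 (m n : nat) (t : R) : R := b m * b n * cos (ph m n t).
(** [psi1] and [psi2] are successive antiderivatives of [psi0]. On the diagonal the frequency [u]
    vanishes and they are polynomials in [t]; elsewhere they are bounded, [psi2] with [u^2] in the
    denominator. *)
Let psi1 (m n : nat) (t : R) : R :=
  b m * b n * (if Nat.eq_dec m n then t else sin (ph m n t) / u m n).
Let psi2 (m n : nat) (t : R) : R :=
  b m * b n * (if Nat.eq_dec m n then t ^ 2 / 2 else - cos (ph m n t) / u m n ^ 2).

Lemma trig_square_expand (t : R) :
  trig_square t = sum_f_R0 (fun m => sum_f_R0 (fun n => psi0 m n t) N) N.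
Proof.
unfold trig_square. simpl. rewrite !Rmult_1_r, !sum_f_R0_mul, <- plus_sum.
apply sum_eq. intros m _. rewrite <- plus_sum. apply sum_eq. intros n _.
unfold psi0, ph, u.
replace (th m - th n + t * (ln (x n) - ln (x m))) with
  ((th m - t * ln (x m)) - (th n - t * ln (x n))) by ring.
rewrite (cos_minus (th m - t * ln (x m))). ring.
Qed.

Let psi1_derive (m n : nat) (t : R) : is_derive (psi1 m n) t (psi0 m n t).
Proof.
unfold psi1, psi0. destruct (Nat.eq_dec m n) as [->|H].
- unfold ph, u. auto_derive; auto.
  replace (th n - th n + t * (ln (x n) - ln (x n))) with 0 by ring. rewrite cos_0. ring.
- unfold ph. pose proof (u_neq_0 m n H). auto_derive; auto. field. assumption.
Qed.

Let psi2_derive (m n : nat) (t : R) : is_derive (psi2 m n) t (psi1 m n t).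
Proof.
unfold psi2, psi1. destruct (Nat.eq_dec m n) as [->|H].
- auto_derive; auto. field.
- unfold ph. pose proof (u_neq_0 m n H). auto_derive; auto. field. assumption.
Qed.

Let Phi (t : R) : R := sum_f_R0 (fun m => sum_f_R0 (fun n => psi1 m n t) N) N.
Let Psi (t : R) : R := sum_f_R0 (fun m => sum_f_R0 (fun n => psi2 m n t) N) N.

Let Phi_derive (t : R) : is_derive Phi t (trig_square t).
Proof.
rewrite trig_square_expand.
apply (is_derive_sum_f_R0 (fun m t => sum_f_R0 (fun n => psi1 m n t) N)
  (fun m t => sum_f_R0 (fun n => psi0 m n t) N)).
intros m. apply (is_derive_sum_f_R0 (psi1 m) (psi0 m)). intros n. apply psi1_derive.
Qed.

Let Psi_derive (t : R) : is_derive Psi t (Phi t).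
Proof.
apply (is_derive_sum_f_R0 (fun m t => sum_f_R0 (fun n => psi2 m n t) N)
  (fun m t => sum_f_R0 (fun n => psi1 m n t) N)).
intros m. apply (is_derive_sum_f_R0 (psi2 m) (psi1 m)). intros n. apply psi2_derive.
Qed.

Lemma trig_square_continuous (t : R) : continuous trig_square t.
Proof.
assert (E : forall f df : nat -> R -> R, (forall n y, is_derive (f n) y (df n y)) ->
  ex_derive (fun y => sum_f_R0 (fun n => f n y) N) t).
{ intros f df H. eexists. apply (is_derive_sum_f_R0 f df). intros n. apply H. }
apply (@ex_derive_continuous R_AbsRing R_NormedModule).
unfold trig_square. apply @ex_derive_plus; apply ex_derive_pow.
- apply (E (fun n t => b n * cos (th n - t * ln (x n)))
    (fun n t => b n * (sin (th n - t * ln (x n)) * ln (x n)))).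
  intros n y. auto_derive; auto. unfold Rminus. ring.
- apply (E (fun n t => b n * sin (th n - t * ln (x n)))
    (fun n t => b n * (- cos (th n - t * ln (x n)) * ln (x n)))).
  intros n y. auto_derive; auto. unfold Rminus. ring.
Qed.

(** The diagonal part of the second differences of [Psi] is exact, [D (q - p + D)] and
    [D (q - p - D)] times the sum of squares, while each of the four values involved contributes at
    most [E] off the diagonal. Dividing by [D] leaves the two error terms. *)
Lemma trig_square_mean (p q D E : R) : 0 < D ->
  (forall m n, (m <= N)%nat -> (n <= N)%nat -> m <> n ->
     0 <= b m * b n) ->
  sum_f_R0 (fun m => sum_f_R0 (fun n =>
     if Nat.eq_dec m n then 0 else b m * b n / u m n ^ 2) N) N <= E ->
  Rabs (RInt trig_square p q - (q - p) * sum_f_R0 (fun n => b n ^ 2) N) <=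
    D * sum_f_R0 (fun n => b n ^ 2) N + 4 * E / D.
Proof.
intros HD Hb HE.
set (H := sum_f_R0 (fun n => b n ^ 2) N).
set (W := sum_f_R0 (fun m => sum_f_R0 (fun n =>
     if Nat.eq_dec m n then 0 else b m * b n / u m n ^ 2) N) N) in *.
assert (EI : RInt trig_square p q = Phi q - Phi p).
{ apply is_RInt_unique. apply (is_RInt_derive (V := R_CompleteNormedModule) Phi trig_square).
  - intros; apply Phi_derive.
  - intros; apply trig_square_continuous. }
rewrite EI.
assert (Pos : forall t, 0 <= trig_square t).
{ intros t. unfold trig_square. apply Rplus_le_le_0_compat; apply pow2_ge_0. }
pose proof (end_point_averaging trig_square Phi Psi p q D HD Phi_derive Psi_derive Pos) as Av.
assert (Diag : forall c, c * H = sum_f_R0 (fun m => sum_f_R0 (fun n =>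
  if Nat.eq_dec m n then c * (b m * b n) else 0) N) N).
{ intros c. unfold H. rewrite scal_sum.
  apply sum_eq. intros m Hm. symmetry.
  clear - Hm. induction N as [|K IH].
  - assert (m = O) by lia. subst m. simpl. ring.
  - rewrite tech5. destruct (Nat.eq_dec m (S K)) as [->|Hne].
    + rewrite (sum_eq _ (fun _ => 0)).
      * rewrite sum_cte. ring.
      * intros i Hi. destruct (Nat.eq_dec (S K) i); [lia|reflexivity].
    + rewrite IH by lia. ring. }
(* Signs and points are left abstract so that the upper and the lower second difference are both
   instances. *)
assert (Comb : forall (a1 a2 a3 a4 c : R) (t1 t2 t3 t4 : R),
  Rabs a1 = 1 -> Rabs a2 = 1 -> Rabs a3 = 1 -> Rabs a4 = 1 ->
  a1 * (t1 ^ 2 / 2) + a2 * (t2 ^ 2 / 2) + a3 * (t3 ^ 2 / 2) + a4 * (t4 ^ 2 / 2) = c ->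
  Rabs (a1 * Psi t1 + a2 * Psi t2 + a3 * Psi t3 + a4 * Psi t4 - c * H) <= 4 * W).
{ intros a1 a2 a3 a4 c t1 t2 t3 t4 A1 A2 A3 A4 Ec.
  rewrite Diag. unfold Psi, W. rewrite !scal_sum, <- !plus_sum.
  apply Rabs_sum_f_R0_minus. intros m Hm.
  rewrite (Rmult_comm _ 4), scal_sum.
  replace (sum_f_R0 (fun n => psi2 m n t1) N * a1 + sum_f_R0 (fun n => psi2 m n t2) N * a2
    + sum_f_R0 (fun n => psi2 m n t3) N * a3 + sum_f_R0 (fun n => psi2 m n t4) N * a4) with
    (sum_f_R0 (fun n => psi2 m n t1 * a1 + psi2 m n t2 * a2 + psi2 m n t3 * a3
       + psi2 m n t4 * a4) N).
  2:{ rewrite !(Rmult_comm (sum_f_R0 _ _)), !scal_sum, <- !plus_sum. reflexivity. }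
  apply Rabs_sum_f_R0_minus. intros n Hn. unfold psi2.
  destruct (Nat.eq_dec m n) as [Emn|Hmn].
  - rewrite <- Ec. replace (_ - _) with 0 by field. rewrite Rabs_R0. lra.
  - pose proof (Hb m n Hm Hn Hmn) as B. pose proof (u_neq_0 m n Hmn) as U.
    assert (U2 : 0 < u m n ^ 2) by (apply pow2_gt_0; exact U).
    set (k := b m * b n / u m n ^ 2).
    assert (K0 : 0 <= k) by (apply Rdiv_le_0_compat; assumption).
    assert (Hc : forall a t, Rabs a = 1 ->
      Rabs (b m * b n * (- cos (ph m n t) / u m n ^ 2) * a) <= k).
    { intros a t Ha.
      replace (b m * b n * (- cos (ph m n t) / u m n ^ 2) * a) with (k * - cos (ph m n t) * a)
        by (unfold k; field; exact U).
      rewrite !Rabs_mult, Ha, Rabs_Ropp, (Rabs_pos_eq k) by exact K0.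
      assert (Rabs (cos (ph m n t)) <= 1) by (apply Rabs_le, COS_bound). nra. }
    rewrite Rminus_0_r.
    pose proof (Hc a1 t1 A1). pose proof (Hc a2 t2 A2).
    pose proof (Hc a3 t3 A3). pose proof (Hc a4 t4 A4).
    eapply Rle_trans; [apply Rabs_triang|].
    eapply Rle_trans; [apply Rplus_le_compat_r, Rabs_triang|].
    eapply Rle_trans; [apply Rplus_le_compat_r, Rplus_le_compat_r, Rabs_triang|]. lra. }
assert (R1 : Rabs 1 = 1) by apply Rabs_R1.
assert (Rm1 : Rabs (-1) = 1) by (rewrite Rabs_left; lra).
pose proof (Comb 1 (-1) (-1) 1 (D * (q - p + D)) (q + D) q p (p - D) R1 Rm1 Rm1 R1
  ltac:(field)) as Up.
pose proof (Comb 1 (-1) (-1) 1 (D * (q - p - D)) q (q - D) (p + D) p R1 Rm1 Rm1 R1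
  ltac:(field)) as Lo.
apply Rabs_le_between in Up. apply Rabs_le_between in Lo.
apply Rabs_le.
assert (HE' : 4 * E / D * D = 4 * E) by (field; lra).
split; apply (Rmult_le_reg_l D); auto; nra.
Qed.

End Trigonometric_polynomial.

(* With [d = n - m], telescoping [1 / d^2 <= 1 / (d - 1/2) - 1 / (d + 1/2)] across [m = n]
   costs [4]. *)
Lemma sum_inv_sqr_dist (n N : nat) : (n <= N)%nat ->
  sum_f_R0 (fun m => if Nat.eq_dec n m then 0 else / (INR n - INR m) ^ 2) N <= 4.
Proof.
intros HnN.
assert (K : forall M, sum_f_R0 (fun m => if Nat.eq_dec n m then 0 else / (INR n - INR m) ^ 2) M
  <= / (INR n - INR M - 1 / 2) + (if le_dec n M then 4 else 0)).
{ induction M as [|M IH].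
  - simpl. destruct (Nat.eq_dec n 0) as [E|H]; destruct (le_dec n 0); try lia; simpl.
    + rewrite E. simpl. replace (0 - 0 - 1 / 2) with (- / 2) by field.
      rewrite Rinv_opp, Rinv_inv. lra.
    + assert (1 <= INR n) by (apply (le_INR 1); lia).
      rewrite Rplus_0_r, Rminus_0_r, Rmult_1_r. apply Rinv_le_contravar; nra.
  - rewrite tech5. eapply Rle_trans; [apply Rplus_le_compat_r, IH|].
    rewrite S_INR.
    destruct (Nat.eq_dec n (S M)) as [->|H].
    + destruct (le_dec (S M) M); [lia|]. destruct (le_dec (S M) (S M)); [|lia].
      rewrite S_INR. replace (INR M + 1 - INR M - 1 / 2) with (/ 2) by field.
      replace (INR M + 1 - (INR M + 1) - 1 / 2) with (- / 2) by field.
      rewrite Rinv_opp, Rinv_inv. lra.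
    + set (d := INR n - (INR M + 1)).
      assert (Hd : d <= -1 \/ 1 <= d).
      { unfold d. destruct (Nat.lt_ge_cases n (S M)) as [L|L].
        - left. apply le_INR in L. rewrite !S_INR in L. lra.
        - right. assert (L' : (S (S M) <= n)%nat) by lia.
          apply le_INR in L'. rewrite !S_INR in L'. lra. }
      replace (INR n - INR M - 1 / 2) with (d + 1 / 2) by (unfold d; field).
      assert (E4 : (if le_dec n M then 4 else 0) = (if le_dec n (S M) then 4 else 0)).
      { destruct (le_dec n M), (le_dec n (S M)); try lia; reflexivity. }
      rewrite E4.
      assert (Hd2 : 1 <= d ^ 2) by nra.
      assert (/ d ^ 2 <= / (d - 1 / 2) - / (d + 1 / 2)).
      { replace (/ (d - 1 / 2) - / (d + 1 / 2)) with (/ (d ^ 2 - 1 / 4)) by (field; lra).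
        apply Rinv_le_contravar; lra. }
      lra. }
eapply Rle_trans; [apply K|]. destruct (le_dec n N); [|lia].
apply le_INR in HnN.
assert (/ (INR n - INR N - 1 / 2) < 0) by (apply Rinv_lt_0_compat; lra). lra.
Qed.

(* The off-diagonal terms satisfy [1 / log (y / x) <= y / (y - x)] for [x < y]. *)
Lemma offdiag_term_bound (x y : R) : 0 < x -> x < y ->
  / sqrt x * / sqrt y / (ln y - ln x) ^ 2 <= y / (y - x) ^ 2 + / x + / (y - x).
Proof.
intros Hx Hxy.
assert (L : (y - x) / y <= ln y - ln x).
{ pose proof (ln_le_minus_1 (x / y) ltac:(apply Rdiv_lt_0_compat; lra)) as H.
  rewrite ln_div in H by lra.
  replace ((y - x) / y) with (- (x / y - 1)) by (field; lra). lra. }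
assert (L0 : 0 < (y - x) / y) by (apply Rdiv_lt_0_compat; lra).
assert (S : / sqrt x * / sqrt y <= / x).
{ rewrite <- Rinv_mult. apply Rinv_le_contravar; [exact Hx|].
  rewrite <- (sqrt_sqrt x) at 1 by lra. apply Rmult_le_compat_l; [apply sqrt_pos|].
  apply sqrt_le_1_alt. lra. }
assert (S0 : 0 < / sqrt x * / sqrt y).
{ apply Rmult_lt_0_compat; apply Rinv_0_lt_compat, sqrt_lt_R0; lra. }
apply Rle_trans with (/ x * / ((y - x) / y) ^ 2).
- unfold Rdiv at 1. apply Rmult_le_compat; [lra| |exact S|].
  + left; apply Rinv_0_lt_compat, pow_lt; lra.
  + apply Rinv_le_contravar; [apply pow_lt, L0|]. apply pow_incr. lra.
- right. field. lra.
Qed.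

(** By symmetry [n] may be taken as the larger index, so the numerator [y] of the leading part is at
    most [INR (S N)]. Each of the [S N] rows then costs [INR (S N)] times [4] for the inverse
    squares plus [1 + 1 / al] for the remaining parts, which are bounded termwise. *)
Lemma offdiag_sum_bound (al : R) (N : nat) : 0 < al <= 1 ->
  sum_f_R0 (fun m => sum_f_R0 (fun n => if Nat.eq_dec m n then 0 else
    / sqrt (INR m + al) * / sqrt (INR n + al)
      / (ln (INR n + al) - ln (INR m + al)) ^ 2) N) N
  <= (5 + / al) * INR (S N) ^ 2.
Proof.
intros Hal.
assert (Hi : 1 <= / al) by (rewrite <- Rinv_1; apply Rinv_le_contravar; lra).
assert (Hterm : forall m n, (m <= N)%nat -> (n <= N)%nat ->
  (if Nat.eq_dec m n then 0 else
    / sqrt (INR m + al) * / sqrt (INR n + al) / (ln (INR n + al) - ln (INR m + al)) ^ 2)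
  <= (if Nat.eq_dec m n then 0 else / (INR m - INR n) ^ 2) * INR (S N) + (1 + / al)).
{ assert (Half : forall m n, (m <= N)%nat -> (n <= N)%nat -> (m < n)%nat ->
    / sqrt (INR m + al) * / sqrt (INR n + al) / (ln (INR n + al) - ln (INR m + al)) ^ 2
    <= / (INR m - INR n) ^ 2 * INR (S N) + (1 + / al)).
  { intros m n Hm Hn Hmn.
    pose proof (pos_INR m) as Pm. rewrite S_INR.
    apply le_INR in Hn. apply le_INR in Hmn. rewrite S_INR in Hmn.
    eapply Rle_trans; [apply offdiag_term_bound; lra|].
    replace (INR n + al - (INR m + al)) with (INR n - INR m) by ring.
    assert (/ (INR m + al) <= / al) by (apply Rinv_le_contravar; lra).
    assert (/ (INR n - INR m) <= 1) by (rewrite <- Rinv_1; apply Rinv_le_contravar; lra).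
    assert ((INR n + al) / (INR n - INR m) ^ 2 <= / (INR m - INR n) ^ 2 * (INR N + 1)).
    { replace ((INR m - INR n) ^ 2) with ((INR n - INR m) ^ 2) by ring.
      unfold Rdiv. rewrite Rmult_comm. apply Rmult_le_compat_l; [|lra].
      left; apply Rinv_0_lt_compat, pow_lt; lra. }
    lra. }
  intros m n Hm Hn. destruct (Nat.eq_dec m n) as [H|H]; [lra|].
  destruct (Nat.lt_ge_cases m n) as [L|L]; [apply Half; assumption|].
  assert (L' : (n < m)%nat) by lia.
  specialize (Half n m Hn Hm L').
  replace ((ln (INR n + al) - ln (INR m + al)) ^ 2) with
    ((ln (INR m + al) - ln (INR n + al)) ^ 2) by ring.
  replace ((INR m - INR n) ^ 2) with ((INR n - INR m) ^ 2) by ring.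
  rewrite (Rmult_comm (/ sqrt (INR m + al))). exact Half. }
replace ((5 + / al) * INR (S N) ^ 2) with (INR (S N) * ((5 + / al) * INR (S N))) by ring.
apply sum_f_R0_le_count. intros m Hm.
eapply Rle_trans; [apply sum_Rle; intros n Hn; apply Hterm; assumption|].
rewrite plus_sum, sum_cte, <- scal_sum.
pose proof (sum_inv_sqr_dist m N Hm) as K.
assert (P : 0 < INR (S N)) by (apply lt_0_INR; lia). nra.
Qed.

Lemma harmonic_bounds (al : R) (N : nat) : 0 < al <= 1 ->
  ln (INR (S N)) <= sum_f_R0 (fun n => / (INR n + al)) N <= ln (INR (S N)) + / al - ln al.
Proof.
intros Hal.
assert (K : ln (INR (S N) + al) - ln al <= sum_f_R0 (fun n => / (INR n + al)) N
  <= / al + ln (INR N + al) - ln al).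
{ induction N as [|N IH].
  - simpl. rewrite Rplus_0_l. pose proof (ln_diff_upper al ltac:(lra)) as U.
    replace (1 + al) with (al + 1) by ring. lra.
  - rewrite tech5. rewrite (S_INR (S N)). pose proof (pos_INR (S N)) as P.
    pose proof (pos_INR N) as P0.
    pose proof (ln_diff_upper (INR (S N) + al) ltac:(lra)) as U.
    pose proof (ln_diff_lower (INR N + al) ltac:(lra)) as L.
    replace (INR N + al + 1) with (INR (S N) + al) in L by (rewrite S_INR; ring).
    replace (INR (S N) + 1 + al) with (INR (S N) + al + 1) by ring. lra. }
pose proof (pos_INR N) as P0. rewrite S_INR in *.
assert (ln (INR N + 1) <= ln (INR N + 1 + al)) by (apply ln_le; lra).
assert (ln (INR N + al) <= ln (INR N + 1)) by (apply ln_le; lra).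
assert (ln al <= 0) by (rewrite <- ln_1; apply ln_le; lra).
lra.
Qed.

Lemma Csum_0_pair (f : nat -> C) (N : nat) :
  Csum f 0 N = (sum_f_R0 (fun n => fst (f n)) N, sum_f_R0 (fun n => snd (f n)) N).
Proof.
induction N as [|N IH].
- rewrite Csum_n_n. apply surjective_pairing.
- rewrite Csum_n_Sm, IH by lia. reflexivity.
Qed.

Lemma lerch_sum_square (al lam : R) (N : nat) (t : R) : 0 < al ->
  Cmod (Csum (lerch_term al lam (1 / 2, t)) 0 N) ^ 2 =
  trig_square (fun n => / sqrt (INR n + al)) (fun n => INR n + al)
    (fun n => 2 * PI * INR n * lam) N t.
Proof.
intros Hal. rewrite Csum_0_pair, Cmod_sqr. cbn [fst snd]. unfold trig_square.
assert (E : forall n, lerch_term al lam (1 / 2, t) n =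
  (/ sqrt (INR n + al) * cos (2 * PI * INR n * lam - t * ln (INR n + al)),
   / sqrt (INR n + al) * sin (2 * PI * INR n * lam - t * ln (INR n + al)))).
{ intros n. pose proof (pos_INR n) as P.
  unfold lerch_term. replace (- ((1 / 2)%R, t))%C with ((- / 2)%R, (- t)%R)
    by (apply injective_projections; simpl; lra).
  rewrite cpow_pos_pair.
  assert (Er : exp (- / 2 * ln (INR n + al)) = / sqrt (INR n + al)).
  { rewrite <- Rpower_sqrt by lra. unfold Rpower. rewrite <- exp_Ropp. f_equal. ring. }
  rewrite Er. unfold cexp. simpl Re. simpl Im. rewrite exp_0, cos_minus, sin_minus.
  rewrite <- (Ropp_mult_distr_l t), cos_neg, sin_neg.
  apply injective_projections; simpl; ring. }
f_equal; f_equal; apply sum_eq; intros n _; rewrite E; reflexivity.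
Qed.

Theorem lerch_sum_mean_square (al lam : R) (N : nat) (p q D : R) : 0 < al <= 1 -> 0 < D ->
  Rabs (RInt (fun t => Cmod (Csum (lerch_term al lam (1 / 2, t)) 0 N) ^ 2) p q
    - (q - p) * sum_f_R0 (fun n => / (INR n + al)) N) <=
  D * sum_f_R0 (fun n => / (INR n + al)) N + 4 * ((5 + / al) * INR (S N) ^ 2) / D.
Proof.
intros Hal HD.
assert (Hx : forall n, 0 < INR n + al) by (intros n; pose proof (pos_INR n); lra).
rewrite (RInt_ext _ (trig_square (fun n => / sqrt (INR n + al)) (fun n => INR n + al)
    (fun n => 2 * PI * INR n * lam) N)) by (intros; apply lerch_sum_square; lra).
rewrite (sum_eq (fun n => / (INR n + al)) (fun n => (/ sqrt (INR n + al)) ^ 2)).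
2:{ intros n _. rewrite pow_inv, pow2_sqrt; [reflexivity|left; apply Hx]. }
apply trig_square_mean; auto.
- intros m n Hmn E. apply Hmn, INR_eq.
  apply ln_inv in E; auto. lra.
- intros m n _ _ _. left. apply Rmult_lt_0_compat; apply Rinv_0_lt_compat, sqrt_lt_R0, Hx.
- apply offdiag_sum_bound, Hal.
Qed.

(** The weighted inequality [2 |b| |a - b| <= |b|^2 / r + r |a - b|^2] replaces Cauchy-Schwarz for
    integrals. With [r = sqrt (log T)], mean squares of order [T log T] for [b] and [T] for [a - b]
    both contribute [T sqrt (log T)]. *)
Lemma Cmod_sqr_perturb (a b : C) (r : R) : 1 <= r ->
  Rabs (Cmod a ^ 2 - Cmod b ^ 2) <= Cmod b ^ 2 / r + 2 * r * Cmod (a - b) ^ 2.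
Proof.
intros Hr.
pose proof (Cmod_ge_0 a) as Ha; pose proof (Cmod_ge_0 b) as Hb.
pose proof (Cmod_ge_0 (a - b)) as Hd.
assert (T1 : Cmod a <= Cmod b + Cmod (a - b)).
{ pose proof (Cmod_triangle b (a - b)) as T. replace (b + (a - b))%C with a in T by ring. exact T. }
assert (T2 : Cmod b <= Cmod a + Cmod (a - b)).
{ pose proof (Cmod_triangle_minus a (a - b)) as T.
  replace (a - (a - b))%C with b in T by ring. exact T. }
set (x := Cmod a) in *. set (y := Cmod b) in *. set (d := Cmod (a - b)) in *.
assert (AG : 2 * y * d <= y ^ 2 / r + r * d ^ 2).
{ assert (E : y ^ 2 / r + r * d ^ 2 - 2 * y * d = (y - r * d) ^ 2 / r) by (field; lra).
  assert (0 <= (y - r * d) ^ 2 / r) by (apply Rdiv_le_0_compat; [apply pow2_ge_0|lra]).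
  lra. }
assert (D2 : d ^ 2 <= r * d ^ 2) by (pose proof (pow2_ge_0 d); nra).
apply Rabs_le. split; nra.
Qed.

(** * Final estimate of the mean square *)

Lemma integral_one_plus_inv_sqr (c T : R) : 0 <= c -> 1 <= T ->
  ex_RInt (fun t => 1 + c / t ^ 2) 1 T /\ RInt (fun t => 1 + c / t ^ 2) 1 T <= T + c.
Proof.
intros Hc HT.
assert (I : is_RInt (fun t => 1 + c / t ^ 2) 1 T ((T - c / T) - (1 - c / 1))).
{ apply (is_RInt_derive (V := R_CompleteNormedModule) (fun t => t - c / t)
    (fun t => 1 + c / t ^ 2)); intros t; rewrite Rmin_left, Rmax_right by lra; intros Ht.
  - auto_derive; [lra|]. field. lra.
  - apply (@ex_derive_continuous R_AbsRing R_NormedModule (fun t => 1 + c / t ^ 2)).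
    auto_derive. nra. }
split; [eexists; exact I|]. rewrite (is_RInt_unique _ _ _ _ I).
assert (0 <= c / T) by (apply Rdiv_le_0_compat; lra). lra.
Qed.

Lemma nat_just_above (x : R) : 0 <= x -> exists n : nat, x <= INR n <= x + 1.
Proof.
intros Hx. destruct (archimed x) as [H1 H2].
assert (0 <= up x)%Z by (apply le_IZR; lra).
exists (Z.to_nat (up x)). rewrite INR_IZR_INZ, Z2Nat.id by assumption. lra.
Qed.

Lemma Cmod_sqr_ex_RInt (f : R -> C) (a b : R) : a <= b ->
  (forall t, a <= t <= b -> continuous (fun y => fst (f y)) t /\ continuous (fun y => snd (f y)) t) ->
  ex_RInt (fun t => Cmod (f t) ^ 2) a b.
Proof.
intros Hab H.
assert (E : forall t, fst (f t) * fst (f t) + snd (f t) * snd (f t) = Cmod (f t) ^ 2)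
  by (intros t; rewrite Cmod_sqr; ring).
apply (ex_RInt_ext (fun t => fst (f t) * fst (f t) + snd (f t) * snd (f t)));
  [intros t _; apply E|].
apply (ex_RInt_continuous (V := R_CompleteNormedModule)). intros t.
rewrite Rmin_left, Rmax_right by lra. intros Ht. destruct (H t Ht) as [C1 C2].
apply (continuous_plus (fun t => fst (f t) * fst (f t)) (fun t => snd (f t) * snd (f t))).
- apply (continuous_mult (fun t => fst (f t)) (fun t => fst (f t))); assumption.
- apply (continuous_mult (fun t => snd (f t)) (fun t => snd (f t))); assumption.
Qed.

Lemma lerch_mean_square_sqrt_log (al lam : R) (F : C -> C) :
  0 < al <= 1 -> 0 < lam <= 1 -> is_lerch_zeta al lam F ->
  exists K, 0 <= K /\ forall T, 3 <= T ->
    Rabs (lerch_mean_square F T - T * ln (T / (2 * PI))) <= K * T * sqrt (ln T).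
Proof.
intros Hal Hlam HF.
destruct (lerch_approximation al lam F Hal Hlam HF) as [K [Q [HK [HQ Happ]]]].
set (c2 := ln (3 * Q) + (/ al - ln al)).
assert (Hlal : ln al <= 0) by (rewrite <- ln_1; apply ln_le; lra).
assert (Hial : 0 < / al) by (apply Rinv_0_lt_compat; lra).
assert (Hl3 : 0 <= ln (3 * Q)) by (rewrite <- ln_1; apply ln_le; lra).
assert (Hc2 : 0 <= c2) by (unfold c2; lra).
(* The three parts bound the diagonal error [D H], the off-diagonal error, with [36 = 4 * 3^2] from
   [N + 1 <= 3 Q T], and the replacement of [(T - 1) H] by [T log T]. *)
set (c4 := (1 + c2) + 36 * (5 + / al) * Q ^ 2 + (2 * c2 + 1)).
assert (Hc4 : 0 <= c4) by (unfold c4; pose proof (pow2_ge_0 Q); nra).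
pose proof PI_RGT_0 as Hpi. pose proof PI2_3_2 as Hpi'.
assert (Hl2pi : 0 <= ln (2 * PI)) by (rewrite <- ln_1; apply ln_le; lra).
exists (c4 + (1 + c4 + 4 * K ^ 2 * (1 + 2 * Q)) + ln (2 * PI)).
split; [pose proof (pow2_ge_0 K); nra|].
intros T HT.
assert (HL : 1 <= ln T).
{ rewrite <- (ln_exp 1). apply ln_le; [apply exp_pos|]. pose proof exp_le_3. lra. }
assert (HLT : ln T <= T) by (pose proof (ln_le_minus_1 T ltac:(lra)); lra).
set (L := ln T) in *. set (r := sqrt L).
assert (Hr : 1 <= r) by (rewrite <- sqrt_1; apply sqrt_le_1_alt, HL).
assert (Hrr : r * r = L) by (apply sqrt_sqrt; lra).
(* One [N >= Q T] satisfies [Q t <= N] for every [t <= T], so a single partial sum serves the whole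
   interval. *)
destruct (nat_just_above (Q * T)) as [N HN]; [nra|].
assert (HQT : 1 <= Q * T) by nra.
set (s := fun t => Cmod (Csum (lerch_term al lam (1 / 2, t)) 0 N) ^ 2).
set (f := fun t => Cmod (F (1 / 2, t)) ^ 2).
set (g := fun t => 1 + 2 * Q * T / t ^ 2).
set (H := sum_f_R0 (fun n => / (INR n + al)) N).
assert (HH : L <= H <= L + c2).
{ pose proof (harmonic_bounds al N Hal) as B. fold H in B. rewrite S_INR in B.
  assert (L <= ln (INR N + 1)) by (apply ln_le; nra).
  assert (ln (INR N + 1) <= ln (3 * Q) + L).
  { unfold L. rewrite <- ln_mult by lra. apply ln_le; nra. }
  unfold c2. lra. }
assert (IS : Rabs (RInt s 1 T - T * L) <= c4 * T * r).
{ pose proof (lerch_sum_mean_square al lam N 1 T (T / r) Hal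
    ltac:(apply Rdiv_lt_0_compat; lra)) as M.
  fold s H in M.
  assert (D1 : T / r * H <= (1 + c2) * T * r).
  { apply Rle_trans with (T / r * (L + c2)).
    - apply Rmult_le_compat_l; [|lra]. apply Rdiv_le_0_compat; lra.
    - rewrite <- Hrr. replace (T / r * (r * r + c2)) with (T * r + c2 * (T / r)) by (field; lra).
      assert (T / r <= T * r).
      { apply (Rmult_le_reg_r r); [lra|]. unfold Rdiv at 1.
        rewrite Rmult_assoc, Rinv_l by lra. assert (1 <= r * r) by nra. nra. }
      nra. }
  assert (D2 : 4 * ((5 + / al) * INR (S N) ^ 2) / (T / r) <= 36 * (5 + / al) * Q ^ 2 * T * r).
  { assert (N2 : INR (S N) ^ 2 <= (3 * (Q * T)) ^ 2).
    { apply pow_incr. rewrite S_INR. pose proof (pos_INR N). lra. }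
    replace (4 * ((5 + / al) * INR (S N) ^ 2) / (T / r)) with
      (4 * (5 + / al) * (r / T) * INR (S N) ^ 2) by (field; lra).
    replace (36 * (5 + / al) * Q ^ 2 * T * r) with
      (4 * (5 + / al) * (r / T) * (3 * (Q * T)) ^ 2) by (field; lra).
    apply Rmult_le_compat_l; [|exact N2].
    assert (0 <= r / T) by (apply Rdiv_le_0_compat; lra). nra. }
  assert (D3 : Rabs ((T - 1) * H - T * L) <= (2 * c2 + 1) * T).
  { apply Rabs_le. split; nra. }
  replace (RInt s 1 T - T * L) with
    ((RInt s 1 T - (T - 1) * H) + ((T - 1) * H - T * L)) by ring.
  eapply Rle_trans; [apply Rabs_triang|].
  assert (T <= T * r) by nra.
  assert ((2 * c2 + 1) * T <= (2 * c2 + 1) * (T * r)) by (apply Rmult_le_compat_l; lra).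
  unfold c4. lra. }
assert (Is : ex_RInt s 1 T).
{ apply (ex_RInt_continuous (V := R_CompleteNormedModule)). intros t _.
  apply (continuous_ext (trig_square (fun n => / sqrt (INR n + al)) (fun n => INR n + al)
    (fun n => 2 * PI * INR n * lam) N)).
  - intros u. unfold s. symmetry. apply lerch_sum_square. lra.
  - apply trig_square_continuous. }
assert (If : ex_RInt f 1 T).
{ apply (Cmod_sqr_ex_RInt (fun t => F (1 / 2, t))); [lra|]. intros t Ht.
  apply (holo_continuous_path F (fun t => (1 / 2, t))); [|intros; apply Cmod_vertical].
  apply holo_of_ex_derive, HF. intros E. apply (f_equal snd) in E. simpl in E. lra. }
destruct (integral_one_plus_inv_sqr (2 * Q * T) T ltac:(nra) ltac:(lra)) as [Ig Bg].
fold g in Ig, Bg.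
assert (Pt : forall t, 1 < t < T -> Rabs (f t - s t) <= / r * s t + 4 * r * K ^ 2 * g t).
{ intros t Ht. unfold f, s.
  eapply Rle_trans; [apply (Cmod_sqr_perturb _ _ r Hr)|].
  pose proof (Happ t N ltac:(lra) ltac:(nra)) as A.
  set (E := Cmod (F ((1 / 2)%R, t) - Csum (lerch_term al lam ((1 / 2)%R, t)) 0 N)) in *.
  assert (E0 : 0 <= E) by apply Cmod_ge_0.
  (* From [(1 + w)^2 <= 2 (1 + w^2)] and [N <= Q T + 1 <= 2 Q T]. *)
  assert (E2 : E ^ 2 <= 2 * K ^ 2 * g t).
  { pose proof (sqrt_pos (INR N)) as S0. pose proof (sqrt_sqrt (INR N) (pos_INR N)) as SS.
    set (w := sqrt (INR N) / t) in *.
    apply Rle_trans with ((K * (1 + w)) ^ 2); [apply pow_incr; lra|].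
    assert (W : w ^ 2 <= 2 * Q * T / t ^ 2).
    { unfold w. replace ((sqrt (INR N) / t) ^ 2) with (sqrt (INR N) * sqrt (INR N) / t ^ 2)
        by (field; lra).
      rewrite SS. apply Rmult_le_compat_r; [|nra].
      left; apply Rinv_0_lt_compat, pow_lt; lra. }
    rewrite Rpow_mult_distr. unfold g.
    replace (2 * K ^ 2 * (1 + 2 * Q * T / t ^ 2)) with
      (K ^ 2 * (2 * (1 + 2 * Q * T / t ^ 2))) by ring.
    apply Rmult_le_compat_l; [apply pow2_ge_0|]. pose proof (pow2_ge_0 (1 - w)). nra. }
  assert (2 * r * E ^ 2 <= 2 * r * (2 * K ^ 2 * g t)) by (apply Rmult_le_compat_l; lra).
  unfold Rdiv. lra. }
assert (IFS : Rabs (RInt f 1 T - RInt s 1 T) <=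
  / r * RInt s 1 T + 4 * r * K ^ 2 * RInt g 1 T).
{ rewrite <- RInt_Rminus, <- !RInt_Rmult, <- RInt_Rplus; auto using ex_RInt_Rmult.
  eapply Rle_trans.
  - apply abs_RInt_le; [lra|]. apply ex_RInt_Rminus; assumption.
  - apply RInt_le; [lra| | |exact Pt].
    + apply (ex_RInt_norm (fun t => f t - s t)).
      apply ex_RInt_Rminus; assumption.
    + apply ex_RInt_Rplus; apply ex_RInt_Rmult; assumption. }
assert (IS' : / r * RInt s 1 T <= (1 + c4) * T * r).
{ apply Rabs_le_between in IS. apply (Rmult_le_reg_l r); [lra|].
  rewrite <- Rmult_assoc, Rinv_r, Rmult_1_l by lra.
  assert (c4 * T * r <= r * (c4 * T * r)) by (assert (0 <= c4 * T * r) by (apply Rmult_le_pos; nra); nra).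
  nra. }
assert (Ig' : 4 * r * K ^ 2 * RInt g 1 T <= 4 * K ^ 2 * (1 + 2 * Q) * T * r).
{ pose proof (pow2_ge_0 K). replace (4 * K ^ 2 * (1 + 2 * Q) * T * r) with
    (4 * r * K ^ 2 * (T + 2 * Q * T)) by ring.
  apply Rmult_le_compat_l; [nra|exact Bg]. }
unfold lerch_mean_square. fold f. rewrite ln_div by lra. fold L.
assert (HTr : ln (2 * PI) * T <= ln (2 * PI) * (T * r)) by (apply Rmult_le_compat_l; nra).
replace (RInt f 1 T - T * (L - ln (2 * PI))) with
  ((RInt f 1 T - RInt s 1 T) + ((RInt s 1 T - T * L) + ln (2 * PI) * T)) by ring.
eapply Rle_trans; [apply Rabs_triang|].
eapply Rle_trans; [apply Rplus_le_compat_l, Rabs_triang|].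
rewrite (Rabs_pos_eq (ln (2 * PI) * T)) by nra. lra.
Qed.

Theorem theorem3 (alpha lambda : R) (F : C -> C) :
  0 < alpha <= 1 -> 0 < lambda <= 1 ->
  is_lerch_zeta alpha lambda F ->
  exists K T0 : R, 1 < T0 /\
    forall T : R, T0 <= T ->
      Rabs (lerch_mean_square F T - T * ln (T / (2 * PI)))
        <= K * T * Rpower (ln T) (if Req_EM_T alpha 1 then 3/4 else 1/2).
Proof.
intros Hal Hlam HF.
destruct (lerch_mean_square_sqrt_log alpha lambda F Hal Hlam HF) as [K [HK H]].
(* Since [e <= 3], [ln T >= 1] from here on, and the square-root bound implies the one with exponent
   [3/4]. *)
exists K, 3. split; [lra|]. intros T HT.
assert (HL : 1 <= ln T).
{ rewrite <- (ln_exp 1). apply ln_le; [apply exp_pos|]. pose proof exp_le_3. lra. }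
apply Rle_trans with (1 := H T HT). apply Rmult_le_compat_l; [nra|].
rewrite <- Rpower_sqrt by lra.
destruct (Req_EM_T alpha 1).
- apply Rle_Rpower; lra.
- apply Rle_Rpower; lra.
Qed.
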